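(* Let $\psi_0$ (scaling function) and $\psi_1,\ldots,\psi_{M-1}$ (mother wavelets) generate an orthonormal $M$-band wavelet decomposition, with dual functions $\psi_0^{\mathrm H},\ldots,\psi_{M-1}^{\mathrm H}$. Let $(N_1,\ldots,N_{M-1})$ be positive integers and define $N_0=\min_{1\le m\le M-1}N_m$. Assume that, for all $m\in\{0,\ldots,M-1\}$, the function $|\widehat\psi_m|^2$ is $2N_m+1$ times continuously differentiable on $\mathbb{R}$ and, for all $q\in\{0,\ldots,2N_m+1\}$, its $q$-th order derivative $(|\widehat\psi_m|^2)^{(q)}$ belongs to $\mathrm L^1(\mathbb{R})$ (the derivative of order $0$ being the function itself). Further assume that, for all $m\ne0$, $\widehat\psi_m(\omega)=O(\omega^{N_m})$ as $\omega\to0$. Then there exists $C\in[0,\infty)$ such that, for all $m\in\{0,\ldots,M-1\}$, $$\forall\tau\in\mathbb{R}\setminus\{0\},\qquad |\gamma_{\psi_m,\psi_m}(\tau)|\le\frac{C}{|\tau|^{2N_m+1}}$$ and $$\forall\tau\in\mathbb{R}\setminus\{0\},\qquad |\gamma_{\psi_m,\psi_m^{\mathrm H}}(\tau)|\le\frac{C}{|\tau|^{2N_m+1}}.$$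
   Context: Fourier transform: $\widehat a(\omega)=\int a(t)e^{-\imath\omega t}dt$. $M\ge 2$ is an integer. $M$-band dual-tree wavelets: $\psi_0\in \mathrm L^2(\mathbb{R})$ is the (real-valued) scaling function and $\psi_1,\ldots,\psi_{M-1}\in \mathrm L^2(\mathbb{R})$ are the (real-valued) mother wavelets of an orthonormal $M$-band multiresolution analysis. They satisfy $\sqrt M\,\widehat\psi_m(M\omega)=H_m(\omega)\widehat\psi_0(\omega)$ for $m\in\{0,\ldots,M-1\}$, where the $H_m$ are $2\pi$-periodic frequency responses satisfying the para-unitarity conditions $\sum_{p=0}^{M-1}H_m(\omega+\frac{2\pi p}{M})H_{m'}^*(\omega+\frac{2\pi p}{M})=M\delta_{m-m'}$ for all $m,m'\in\{0,\ldots,M-1\}$; the filter $H_0$ is low-pass, with the usual condition $\widehat\psi_0(0)=1$. The functions $M^{-j/2}\psi_m(M^{-j}t-k)$, $1\le m\le M-1$, $j,k\in\mathbb{Z}$, form an orthonormal basis of $\mathrm L^2(\mathbb{R})$, and $\{\psi_m(\cdot-k): 0\le m\le M-1,\ k\in\mathbb{Z}\}$ is an orthonormal family. The dual functions $\psi_m^{\mathrm H}$ (real-valued, in $\mathrm L^2(\mathbb{R})$) are given by $\widehat\psi{}_m^{\mathrm H}(\omega)=-\imath\,\mathrm{sign}(\omega)\widehat\psi_m(\omega)$ for $m\ge1$ and, with $d$ a fixed integer, by $\widehat\psi{}_0^{\mathrm H}(\omega)=(-1)^k e^{-\imath(d+\frac12)\omega}\widehat\psi_0(\omega)$ if $\omega\in[2k\pi,2(k+1)\pi)$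 with $k\ge0$, and $\widehat\psi{}_0^{\mathrm H}(\omega)=(-1)^{k+1} e^{-\imath(d+\frac12)\omega}\widehat\psi_0(\omega)$ if $\omega\in[2k\pi,2(k+1)\pi)$ with $k<0$. Cross-correlation of real-valued $f,g\in \mathrm L^2(\mathbb{R})$: $\gamma_{f,g}(\tau)=\int_{-\infty}^\infty f(x)g(x-\tau)\,dx$. *)

(* Defs.v *)
From HB Require Import structures.
From mathcomp Require Import all_boot all_order all_algebra.
From mathcomp Require Import complex.
From mathcomp Require Import all_classical all_reals all_analysis.
Import Order.TTheory GRing.Theory Num.Theory.
Import numFieldNormedType.Exports.

Set Implicit Arguments.
Unset Strict Implicit.
Unset Printing Implicit Defensive.

Local Open Scope classical_set_scope.
Local Open Scope complex_scope.
Local Open Scope ring_scope.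

Section L2.
Context {R : realType}.
Local Notation mu := (@lebesgue_measure R).

(* Elements of L^2(R) are represented by functions; two representatives are
   identified only through a.e. equality. *)
Definition L2 : set (R -> R) := [set f | f \in Lfun mu 2%:E].

Definition L2dist (f g : R -> R) : \bar R :=
  'N[mu]_(2%:E)[EFin \o (fun x => (f x - g x)%R)]%E.

Definition inner (f g : R -> R) : R := \int[mu]_x (f x * g x).

Definition orthonormal (I : eqType) (e : I -> R -> R) : Prop :=
  (forall i, L2 (e i)) /\ (forall i j, inner (e i) (e j) = (i == j)%:R).

(* Real scalars suffice: for real-valued e, the complex closed span is the
   complexification of this real one. *)
Definition closed_span (I : Type) (e : I -> R -> R) : set (R -> R) :=
  [set f | L2 f /\ forall eps : R, 0 < eps ->
    exists (s : seq I) (c : I -> R),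
      (L2dist f (fun x => (\sum_(i <- s) c i * e i x)%R) < eps%:E)%E].

Definition orthonormal_basis (I : eqType) (e : I -> R -> R) (V : set (R -> R))
  : Prop := orthonormal e /\ closed_span e = V.

Definition crosscorr (f g : R -> R) (tau : R) : R :=
  \int[mu]_x (f x * g (x - tau)).

End L2.

Section Fourier.
Context {R : realType}.
Local Notation mu := (@lebesgue_measure R).

Definition expi (x : R) : R[i] := cos x +i* sin x.

Definition sqmod (F : R -> R[i]) (w : R) : R := ComplexField.Normc.normc (F w) ^+ 2.

(* The integral of a(t) exp(-i w t) over [-n, n], for real-valued a; it
   converges absolutely for a in L^2(R). *)
Definition fourier_trunc (a : R -> R) (n : nat) (w : R) : R[i] :=
  (\int[mu]_(t in `[- n%:R, n%:R]) (a t * cos (w * t)))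
  -i* (\int[mu]_(t in `[- n%:R, n%:R]) (a t * sin (w * t))).

(* F is a representative of the Fourier-Plancherel transform of a: the L^2-limit
   of the transforms of the truncations of a. It is unique up to a.e. equality,
   whence a relation rather than a function. *)
Definition is_fourier (a : R -> R) (F : R -> R[i]) : Prop :=
  [/\ L2 a,
      L2 (fun w => complex.Re (F w)),
      L2 (fun w => complex.Im (F w)) &
      (fun n => 'N[mu]_(2%:E)[EFin \o
         (fun w => ComplexField.Normc.normc (F w - fourier_trunc a n w)%R)])%E @ \oo --> 0%E].

End Fourier.

Section Wavelets.
Context {R : realType}.
Local Notation mu := (@lebesgue_measure R).

Definition atom (M : nat) (f : R -> R) (j k : int) (t : R) : R :=
  M%:R `^ (- (j%:~R / 2)) * f (M%:R ^ (- j) * t - k%:~R).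

Definition approx_space (M : nat) (phi : R -> R) (j : int) : set (R -> R) :=
  closed_span (fun k : int => atom M phi j k).

(* The scale relation between the V_j holds by construction of approx_space. *)
Record multiresolution (M : nat) (phi : R -> R) : Prop := {
  mra_translates : orthonormal (fun k : int => atom M phi 0 k);
  mra_nested : forall j : int,
    approx_space M phi (j + 1) `<=` approx_space M phi j;
  mra_separated : forall f : R -> R,
    (forall j : int, approx_space M phi j f) -> {ae mu, forall x, f x = 0};
  mra_dense : forall f : R -> R, L2 f -> forall eps : R, 0 < eps ->
    exists (j : int) (g : R -> R),
      approx_space M phi j g /\ (L2dist f g < eps%:E)%E }.

(* psi 0 is the scaling function, psi 1, ..., psi (M - 1) the mother wavelets,
   and hatpsi m a representative of the Fourier transform of psi m; values at
   m >= M are irrelevant. The relations between the H m and the hatpsi m are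
   identities between classes of functions, hence a.e. ones. *)
Record orthonormal_Mband (M : nat) (psi : nat -> R -> R)
    (hatpsi H : nat -> R -> R[i]) : Prop := {
  mb_fourier : forall m, (m < M)%N -> is_fourier (psi m) (hatpsi m);
  mb_mra : multiresolution M (psi 0%N);
  mb_split : orthonormal_basis
    (fun mk : 'I_M * int => atom M (psi mk.1) 0 mk.2)
    (approx_space M (psi 0%N) (- 1));
  (* i : 'I_(M - 1) stands for the wavelet index m = i + 1 *)
  mb_basis : orthonormal_basis
    (fun mjk : 'I_M.-1 * int * int => atom M (psi mjk.1.1.+1) mjk.1.2 mjk.2)
    L2;
  mb_measurable : forall m, (m < M)%N ->
    measurable_fun setT (fun w => complex.Re (H m w)) /\
    measurable_fun setT (fun w => complex.Im (H m w));
  mb_periodic : forall m, (m < M)%N -> forall w, H m (w + 2 * pi) = H m w;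
  mb_two_scale : forall m, (m < M)%N -> {ae mu, forall w : R,
    (Num.sqrt M%:R)%:C * hatpsi m (M%:R * w) = H m w * hatpsi 0%N w};
  mb_paraunitary : forall m m', (m < M)%N -> (m' < M)%N ->
    {ae mu, forall w : R,
      \sum_(p < M) H m (w + 2 * pi * p%:R / M%:R)
                   * (H m' (w + 2 * pi * p%:R / M%:R))^*%C
      = (M * (m == m'))%:R};
  mb_lowpass : hatpsi 0%N 0 = 1 }.

(* floor (w / (2 pi)) is the k such that w lies in [2 k pi, 2 (k+1) pi). *)
Definition dual_phase (d : int) (w : R) : R[i] :=
  let k := Num.floor (w / (2 * pi)) in
  (if 0 <= k then (- 1) ^ k else (- 1) ^ (k + 1))
  * expi (- ((d%:~R + 1 / 2) * w)).

Definition dual_hat (d : int) (hatpsi : nat -> R -> R[i]) (m : nat) (w : R)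
  : R[i] :=
  if m == 0%N then dual_phase d w * hatpsi 0%N w
  else (0 -i* Num.sg w) * hatpsi m w.

End Wavelets.

Definition Ck {R : realType} (n : nat) (f : R -> R) : Prop :=
  (forall q, (q < n)%N -> forall x, derivable (derive1n q f) x 1) /\
  continuous (derive1n n f).

(* Main.v *)
Require Import Defs.
From HB Require Import structures.
From mathcomp Require Import all_boot all_order all_algebra.
From mathcomp Require Import complex.
From mathcomp Require Import all_classical all_reals all_analysis.
From mathcomp Require Import measurable_realfun.
From mathcomp Require Import ring lra.
Import Order.TTheory GRing.Theory Num.Theory.
Import numFieldNormedType.Exports.

Local Open Scope classical_set_scope.
Local Open Scope complex_scope.
Local Open Scope ring_scope.

(** A cross-correlation is a Fourier integral: 2 pi gamma_{f,g}(tau) is the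
    integral over w of the real part of F(w) conj(G(w)) exp(i tau w), where F
    and G are the transforms of f and g ([crosscorr_parseval]). With
    S = |hatpsi_m|^2, every correlation at stake has an integrand of the form
      eps(floor(w / (2 pi))) S(w) cos((tau + c) w + t),   |eps| <= 1:
    eps = 1, c = t = 0 for the autocorrelations; eps the sign of the cell and
    t = pi / 2 for a wavelet against its dual; eps alternating away from the
    origin and c = d + 1/2 for the scaling function against its dual.

    Integrate by parts n + 1 = 2 N_m + 1 times, on each cell
    [2 k pi, 2 (k + 1) pi] separately ([step_fourier_decay]). Each integration
    gains a factor 1 / |tau + c|. Boundary terms at a common endpoint of two
    cells cancel when eps takes the same value on both, and vanish when the
    derivative of S at that endpoint does. In the last integration no
    cancellation is available, since the derivative of order n = 2 N_m may be
    nonzero at the jumps of eps; but the boundary terms are then absolutely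
    summable over the cells, because a function is bounded on a cell by its mean
    and its total variation there ([pointwise_le_Rintegral]).

    It remains to see that the derivatives of S of order less than 2 N_m vanish
    at the jumps of eps. A smooth S with S(w) = O(|w - a|^(2 N)) has vanishing
    derivatives of order less than 2 N at a ([flat_derivatives]). For a wavelet
    the only jump is at 0, where this bound is the assumption on hatpsi_m. For
    the scaling function, the phase of the dual makes the two cells around 0
    carry the same sign, and the jumps are at 2 k pi with k nonzero. The
    flatness of |hatpsi_0|^2 there is a property of the filter bank
    ([scaling_flat]). Near 0 the function hatpsi_0 is bounded below, so by the
    two-scale relations the high-pass filters are flat at 0. Para-unitarity says
    that the rows of the matrix (H_m(w + 2 pi p / M))_{m,p} are orthogonal of
    squared norm M; then so are its columns, and comparing the first row with
    the first column shows that H_0 is flat at 2 pi p / M for 0 < p < M. The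
    two-scale relation for hatpsi_0 carries this flatness to 2 k pi when M does
    not divide k, and reduces k to k / M when it does.

    Two points are of a technical nature. The transforms are only given by
    the Fourier-Plancherel relation, so the correlation formula rests on
    Parseval's identity in L^2, which is obtained by damping the integral
    with exp(- e |w|), whose transform is the Poisson kernel, and letting e
    tend to 0 ([parseval_compact]). The filter identities hold only almost
    everywhere; they yield pointwise bounds because an almost everywhere
    inequality between continuous functions holds everywhere
    ([ae_le_continuous]). *)

Set Implicit Arguments.
Unset Strict Implicit.
Unset Printing Implicit Defensive.

(** * Affine changes of variable *)
Section affine.
Context {R : realType}.
Local Notation mu := (@lebesgue_measure R).

Lemma measurable_affine (a b : R) :
  measurable_fun [set: R] (fun x : R => a * x + b).
Proof.
by apply: measurable_funD; [exact: measurable_funM|exact: measurable_cst].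
Qed.

(** By uniqueness of the Lebesgue measure: the rescaled image measure gives
    half-open intervals their length. *)
Lemma lebesgue_affine (a b : R) (A : set R) : 0 < a -> measurable A ->
  mu ((fun x => a * x + b) @^-1` A) = ((a^-1)%:E * mu A)%E.
Proof.
move=> a0 mA; pose phi := fun x : R => a * x + b.
have mphi : measurable_fun [set: measurableTypeR R] (phi : measurableTypeR R -> measurableTypeR R).
  exact: measurable_affine.
pose nu := mscale (NngNum (ltW a0)) (measure_function_pushforward__canonical__measure_function_Measure mu mphi).
suff : mu A = nu A.
  rewrite /nu /mscale /pushforward /= => ->.
  by rewrite muleA -EFinM mulVf ?gt_eqF// mul1e.
apply: (@lebesgue_measure_unique R nu) => // _ [[s t]] _ <-.
rewrite -[RHS]/(a%:E * mu (phi @^-1` `]s, t]%classic))%E.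
have -> : phi @^-1` `]s, t]%classic = `](s - b) / a, (t - b) / a]%classic.
  apply/seteqP; split => x /=; rewrite !in_itv/= /phi;
  by rewrite ltr_pdivrMr// ler_pdivlMr// ltrBlDr lerBrDr (mulrC x).
rewrite !lebesgue_measure_itv/= !lte_fin ltr_pM2r ?invr_gt0// ltrD2r.
case: ifPn => _; last by rewrite mule0.
by rewrite -!EFinD -EFinM -mulrBl opprB addrA subrK mulrCA divff ?gt_eqF// mulr1.
Qed.

Lemma ae_affine (a b : R) (P : R -> Prop) : 0 < a ->
  {ae mu, forall x, P x} -> {ae mu, forall x, P (a * x + b)}.
Proof.
move=> a0 [N [mN N0 PN]]; exists ((fun x => a * x + b) @^-1` N); split.
- by rewrite -[X in measurable X]setTI; exact: measurable_affine.
- by rewrite lebesgue_affine// [X in (_ * X)%E]N0 mule0.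
- by move=> x /= nP; apply: PN.
Qed.

Lemma ge0_integral_affine (a b : R) (f : R -> \bar R) : 0 < a ->
  measurable_fun setT f -> (forall x, 0 <= f x)%E ->
  (\int[mu]_x f (a * x + b)%R = (a^-1)%:E * \int[mu]_x f x)%E.
Proof.
move=> a0 mf f0; pose phi := (fun x : R => a * x + b) : measurableTypeR R -> measurableTypeR R.
have mphi : measurable_fun setT phi by exact: measurable_affine.
have /= <- := @ge0_integral_pushforward _ _ _ _ R phi mphi mu setT f measurableT mf (fun x _ => f0 x).
have ai0 : 0 <= a^-1 by rewrite invr_ge0 ltW.
rewrite (eq_measure_integral (mscale (NngNum ai0) mu)); last first.
  by move=> A mA _; exact: lebesgue_affine.
by rewrite ge0_integral_mscale//=.
Qed.

Lemma integrable_affine (a b : R) (f : R -> R) : 0 < a ->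
  mu.-integrable setT (EFin \o f) ->
  mu.-integrable setT (EFin \o (fun x => f (a * x + b))).
Proof.
move=> a0 /integrableP[mf fi]; apply/integrableP; split.
  have /measurable_EFinP mf' := mf.
  apply/measurable_EFinP; apply: (measurableT_comp mf'); exact: measurable_affine.
have := @ge0_integral_affine a b (fun x => `|(EFin \o f) x|)%E a0.
rewrite /= => ->//; first by apply: lte_mul_pinfty => //; rewrite ?lee_fin ?invr_ge0 ?(ltW a0).
by apply/measurable_EFinP; apply: measurableT_comp => //; exact/measurable_EFinP.
Qed.

(** The positive and negative parts are treated separately by the change of
    variable for image measures. *)
Lemma Rintegral_affine (a b : R) (f : R -> R) : 0 < a ->
  mu.-integrable setT (EFin \o f) ->
  \int[mu]_x f (a * x + b) = a^-1 * \int[mu]_x f x.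
Proof.
move=> a0 fi.
pose phi := (fun x : R => a * x + b) : measurableTypeR R -> measurableTypeR R.
have mphi : measurable_fun setT phi by exact: measurable_affine.
have mf := measurable_int _ fi.
have fia := integrable_affine b a0 fi.
have /= h := @integral_pushforward _ _ _ _ R phi mphi mu setT (EFin \o f) mf fia measurableT.
rewrite /Rintegral -h.
have ai0 : 0 <= a^-1 by rewrite invr_ge0 ltW.
rewrite (eq_measure_integral (mscale (NngNum ai0) mu)); last first.
  by move=> A mA _; exact: lebesgue_affine.
rewrite integralE !ge0_integral_mscale//=; last 2 first.
  exact: measurable_funeneg.
  exact: measurable_funepos.
rewrite [in RHS]integralE -muleBr ?fineM//=.
- by rewrite fin_numB integrable_pos_fin_num ?integrable_neg_fin_num.
- by apply: fin_num_adde_defr; rewrite integrable_pos_fin_num.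
Qed.

End affine.

(** * Integrable and square-integrable functions *)
Section tools.
Context {R : realType}.
Local Notation mu := (@lebesgue_measure R).
Local Notation L1 f := (mu.-integrable setT (EFin \o f)).

Lemma L1_measurable (f : R -> R) : L1 f -> measurable_fun setT f.
Proof. by move=> /(measurable_int mu) /measurable_EFinP. Qed.

Lemma L1_le (f g : R -> R) : measurable_fun setT f -> L1 g ->
  (forall x, `|f x| <= g x) -> L1 f.
Proof.
move=> mf gi fg; apply: (le_integrable _ _ _ gi) => //.
  exact/measurable_EFinP.
move=> x _ /=; rewrite lee_fin (le_trans (fg x))// ler_norm//.
Qed.

Lemma L1D (f g : R -> R) : L1 f -> L1 g -> L1 (fun x => f x + g x).
Proof. by move=> fi gi; exact: (integrableD _ fi gi). Qed.

Lemma L1B (f g : R -> R) : L1 f -> L1 g -> L1 (fun x => f x - g x).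
Proof. by move=> fi gi; exact: (integrableB _ fi gi). Qed.

Lemma L1Z (c : R) (f : R -> R) : L1 f -> L1 (fun x => c * f x).
Proof. by move=> fi; exact: (integrableZl _ c fi). Qed.

Lemma L1_norm (f : R -> R) : L1 f -> L1 (fun x => `|f x|).
Proof. by move=> fi; exact: (integrable_norm fi). Qed.

Lemma L1M_bounded (b f : R -> R) (c : R) : measurable_fun setT b ->
  (forall x, `|b x| <= c) -> L1 f -> L1 (fun x => b x * f x).
Proof.
move=> mb bc fi; apply: (@L1_le _ (fun x => c * `|f x|)).
- by apply: measurable_funM => //; exact: L1_measurable.
- by apply: L1Z; exact: L1_norm.
- by move=> x; rewrite normrM ler_wpM2r.
Qed.

Lemma L1_fin_num (f : R -> R) : L1 f -> (\int[mu]_x (f x)%:E)%E \is a fin_num.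
Proof. by move=> fi; exact: (integrable_fin_num _ fi). Qed.

Lemma RintegralE (f : R -> R) : L1 f -> ((\int[mu]_x f x)%:E = \int[mu]_x (f x)%:E)%E.
Proof. by move=> fi; rewrite /Rintegral fineK// L1_fin_num. Qed.

Lemma Rintegral_dominated (f_ : nat -> R -> R) (f g : R -> R) :
  (forall n, measurable_fun setT (f_ n)) -> measurable_fun setT f ->
  (forall x, f_ n x @[n --> \oo] --> f x) -> L1 g ->
  (forall n x, `|f_ n x| <= g x) ->
  \int[mu]_x f_ n x @[n --> \oo] --> \int[mu]_x f x.
Proof.
move=> mf_ mf ff gi fg.
have fi : L1 f.
  apply: (L1_le mf gi) => x.
  apply: (@closed_cvg _ _ _ eventually_filter (fun n => `|f_ n x|) [set y | y <= g x]).
  - exact: closed_le.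
  - by apply: nearW => n /=; exact: fg.
  - by apply: cvg_norm; exact: ff.
have [] := @dominated_convergence _ _ R mu setT measurableT (fun n => EFin \o f_ n)
  (EFin \o f) (EFin \o g).
- by move=> n; apply/measurable_EFinP; exact: mf_.
- by apply/measurable_EFinP; exact: mf.
- by apply: aeW => x _ /=; apply: cvg_EFin; [exact: nearW|exact: ff].
- exact: gi.
- by apply: aeW => x n _ /=; rewrite lee_fin.
move=> _ _ h; apply: fine_cvg; rewrite [X in _ --> X]RintegralE//.
Qed.

(** The bound on the sections is what Tonelli's criterion asks for; it is kept
    pointwise, rather than almost everywhere, as all the kernels below are
    dominated explicitly. *)
Lemma integrable_prod (F : R * R -> R) (G : R -> R) : measurable_fun setT F -> L1 G ->
  (forall x, \int[mu]_y `|F (x, y)|%:E <= (G x)%:E)%E ->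
  (mu \x mu)%E.-integrable setT (EFin \o F).
Proof.
move=> mF Gi FG.
have mFE : measurable_fun setT (EFin \o F) by exact/measurable_EFinP.
apply/integrable12ltyP => //.
apply: (@le_lt_trans _ _ (\int[mu]_x (G x)%:E)%E).
  apply: ge0_le_integral => //=.
  - by move=> x _; exact: integral_ge0.
  - apply: (@measurable_fun_fubini_tonelli_F _ _ _ _ _ mu (abse \o (EFin \o F))) => //=.
    exact: measurableT_comp.
  - exact: (measurable_int _ Gi).
by rewrite -RintegralE// ltry.
Qed.

Lemma Rintegral_section_L1 (F : R * R -> R) (G : R -> R) : measurable_fun setT F ->
  L1 G -> (forall x, \int[mu]_y `|F (x, y)|%:E <= (G x)%:E)%E ->
  L1 (fun x => \int[mu]_y F (x, y)).
Proof.
move=> mF Gi FG; have iF := integrable_prod mF Gi FG.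
have mFF : measurable_fun setT (fun x => \int[mu]_y (F (x, y))%:E)%E.
  exact: (measurable_fubini_F iF).
apply: (L1_le _ Gi).
  exact: (measurableT_comp (@fine_measurable R setT measurableT) mFF).
move=> x.
have mFx : measurable_fun setT (fun y => F (x, y)).
  by apply: (measurableT_comp mF); exact: pair1_measurable.
have Fxi : L1 (fun y => F (x, y)).
  apply/integrableP; split; first by apply/measurable_EFinP; exact: mFx.
  by rewrite (le_lt_trans (FG x))// ltry.
rewrite (le_trans (le_normr_Rintegral _ _))// -lee_fin RintegralE//.
exact: L1_norm.
Qed.

(** Real-valued integrals are 0 by convention where the section is not
    integrable, which happens only on a null set. *)
Lemma Rfubini (F : R * R -> R) (G : R -> R) : measurable_fun setT F -> L1 G ->
  (forall x, \int[mu]_y `|F (x, y)|%:E <= (G x)%:E)%E ->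
  \int[mu]_x (\int[mu]_y F (x, y)) = \int[mu]_y (\int[mu]_x F (x, y)) /\
  L1 (fun y => \int[mu]_x F (x, y)).
Proof.
move=> mF Gi FG.
have mFE : measurable_fun setT (EFin \o F) by exact/measurable_EFinP.
have iF := integrable_prod mF Gi FG.
have mF2 y : measurable_fun setT (fun x => F (x, y)).
  by apply: (measurableT_comp mF); exact: pair2_measurable.
have mfG : measurable_fun setT (fun y => \int[mu]_x (F (x, y))%:E)%E.
  exact: (measurable_fubini_G iF).
have Gfin : {ae mu, forall y, setT y ->
    (\int[mu]_x (F (x, y))%:E)%E = (\int[mu]_x F (x, y))%:E}.
  have := ae_integrable2 iF; apply: filterS => y /= yi _.
  by rewrite -RintegralE.
have mG : measurable_fun setT (fun y => \int[mu]_x F (x, y)).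
  exact: (measurableT_comp (@fine_measurable R setT measurableT) mfG).
have mA : measurable_fun setT (fun y => \int[mu]_x `|F (x, y)|%:E)%E.
  apply: (@measurable_fun_fubini_tonelli_G _ _ _ _ _ mu (abse \o (EFin \o F))) => //=.
  exact: measurableT_comp.
split; last first.
  apply/integrableP; split; first by apply/measurable_EFinP; exact: mG.
  have := (integrable21ltyP mu mu mFE).1 iF; apply: le_lt_trans.
  apply: ge0_le_integral => //=.
  - by apply/measurable_EFinP; apply: measurableT_comp => //; exact: mG.
  - move=> y _.
    have [yi|] := boolP ((\int[mu]_x (F (x, y))%:E)%E \is a fin_num).
      rewrite -abse_EFin /Rintegral fineK//.
      by apply: le_abse_integral => //; apply/measurable_EFinP; exact: mF2.
    rewrite /Rintegral fin_numE negb_and !negbK => /orP[]/eqP ->;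
    by rewrite /= normr0 integral_ge0.
rewrite {1}/Rintegral.
rewrite (@eq_integral _ _ _ mu setT (fun x => \int[mu]_y (F (x, y))%:E)%E); last first.
  move=> x _; rewrite RintegralE//.
  apply/integrableP; split.
    by apply/measurable_EFinP; apply: (measurableT_comp mF); exact: pair1_measurable.
  by rewrite (le_lt_trans (FG x))// ltry.
rewrite (Fubini iF) /Rintegral; congr fine.
by apply: ae_eq_integral => //; apply/measurable_EFinP; exact: mG.
Qed.

Lemma L2P (f : R -> R) : L2 f <-> measurable_fun setT f /\ L1 (fun x => f x ^+ 2).
Proof.
rewrite /L2 /=; split=> [fL|[mf fi]].
  split; last exact: Lfun2_integrable_sqr.
  by move: fL; rewrite inE => /andP[]; rewrite inE.
rewrite inE; apply/andP; split; rewrite inE//=.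
rewrite /finite_norm unlock poweR_lty//.
case/integrableP: fi => _; apply: le_lt_trans; rewrite le_eqVlt; apply/orP; left.
by apply/eqP/eq_integral => x _; rewrite /= powR_mulrn// -normrX.
Qed.

Lemma L2_measurable (f : R -> R) : L2 f -> measurable_fun setT f.
Proof. by case/L2P. Qed.

Lemma L2_sqr (f : R -> R) : L2 f -> L1 (fun x => f x ^+ 2).
Proof. by case/L2P. Qed.

Lemma L2_mul (f g : R -> R) : L2 f -> L2 g -> L1 (fun x => f x * g x).
Proof. by move=> fL gL; apply/Lfun1_integrable; exact: Lfun2_mul_Lfun1. Qed.

Lemma L2_le (f g : R -> R) : measurable_fun setT f -> L2 g ->
  (forall x, `|f x| <= `|g x|) -> L2 f.
Proof.
move=> mf gL fg; apply/L2P; split => //.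
apply: (L1_le _ (L2_sqr gL)); first exact: measurable_funX.
by move=> x; rewrite normrX -[leRHS]real_normK ?num_real// lerXn2r ?nnegrE.
Qed.

Lemma L2Z (c : R) (f : R -> R) : L2 f -> L2 (fun x => c * f x).
Proof.
move=> fL; apply/L2P; split; first by apply: measurable_funM => //; exact: L2_measurable.
by under eq_fun do rewrite exprMn; apply: L1Z; exact: L2_sqr.
Qed.

Lemma L2D (f g : R -> R) : L2 f -> L2 g -> L2 (fun x => f x + g x).
Proof.
move=> fL gL; apply/L2P; split.
  by apply: measurable_funD; exact: L2_measurable.
under eq_fun do rewrite sqrrD.
by apply: L1D; [apply: L1D|]; rewrite ?L2_sqr//; apply: (L1D (L2_mul fL gL) (L2_mul fL gL)).
Qed.

Lemma L2B (f g : R -> R) : L2 f -> L2 g -> L2 (fun x => f x - g x).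
Proof.
move=> fL gL; have := L2D fL (L2Z (-1) gL).
by under eq_fun do rewrite mulN1r.
Qed.

(** The quadratic polynomial t |-> \int (f - t g)^2 is nonnegative: evaluate it
    at its minimum, or at a large argument if g = 0 almost everywhere. *)
Lemma cauchy_schwarz (f g : R -> R) : L2 f -> L2 g ->
  `|\int[mu]_x (f x * g x)| <=
  Num.sqrt (\int[mu]_x (f x ^+ 2)) * Num.sqrt (\int[mu]_x (g x ^+ 2)).
Proof.
move=> fL gL.
set A := \int[mu]_x (f x ^+ 2); set B := \int[mu]_x (f x * g x).
set C := \int[mu]_x (g x ^+ 2).
have A0 : 0 <= A by apply: Rintegral_ge0 => x _; exact: sqr_ge0.
have C0 : 0 <= C by apply: Rintegral_ge0 => x _; exact: sqr_ge0.
have H t : 0 <= A - 2 * t * B + t ^+ 2 * C.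
  have -> : A - 2 * t * B + t ^+ 2 * C = \int[mu]_x ((f x - t * g x) ^+ 2).
    rewrite -RintegralZl ?L2_mul// -RintegralZl ?L2_sqr// -RintegralB ?L2_sqr//; last first.
      by apply: L1Z; exact: L2_mul.
    rewrite -RintegralD//; last 2 first.
    - by apply: L1B; [exact: L2_sqr|apply: L1Z; exact: L2_mul].
    - by apply: L1Z; exact: L2_sqr.
    by apply: eq_Rintegral => x _; ring.
  by apply: Rintegral_ge0 => x _; exact: sqr_ge0.
rewrite -sqrtrM// -sqrtr_sqr ler_sqrt ?mulr_ge0//.
have [C00|Cn0] := eqVneq C 0.
  suff -> : B = 0 by rewrite expr0n/= mulr_ge0.
  apply/eqP; apply/negP => /negP B0.
  have := H ((A + 1) / (2 * B)); rewrite C00 mulr0 addr0.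
  have -> : A - 2 * ((A + 1) / (2 * B)) * B = -1 by field.
  by rewrite ler0N1.
have := H (B / C).
have -> : A - 2 * (B / C) * B + (B / C) ^+ 2 * C = (A * C - B ^+ 2) / C by field.
have Cp : 0 < C by rewrite lt_neqAle eq_sym Cn0.
by rewrite pmulr_lge0 ?invr_gt0// subr_ge0.
Qed.

End tools.

(** * Calculus on segments *)
Section calculus.
Context {R : realType}.
Local Notation mu := (@lebesgue_measure R).
Local Notation L1 f := (mu.-integrable setT (EFin \o f)).

Lemma is_derive_affine (c d x : R) : is_derive x 1 (fun w : R => c * w + d) c.
Proof.
have -> : (fun w : R => c * w + d) = (c \*: (id : R -> R)) + cst d by [].
by apply: is_derive_eq; rewrite addr0 /GRing.scale/= mulr1.
Qed.

Lemma is_derive_cos_affine (c d x : R) :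
  is_derive x 1 (fun w : R => cos (c * w + d)) (- sin (c * x + d) * c).
Proof. exact: (is_derive1_comp (is_derive_cos _) (is_derive_affine c d x)). Qed.

Lemma is_derive_sin_affine (c d x : R) :
  is_derive x 1 (fun w : R => sin (c * w + d)) (cos (c * x + d) * c).
Proof. exact: (is_derive1_comp (is_derive_sin _) (is_derive_affine c d x)). Qed.

Lemma is_derive_expR_affine (c d x : R) :
  is_derive x 1 (fun w : R => expR (c * w + d)) (expR (c * x + d) * c).
Proof. exact: (is_derive1_comp (is_derive_expR _) (is_derive_affine c d x)). Qed.

Lemma is_derive_continuous (F f : R -> R) :
  (forall x : R, is_derive x 1 F (f x)) -> continuous F.
Proof.
move=> dF x; apply: differentiable_continuous.
by apply/derivable1_diffP; case: (dF x).
Qed.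

Lemma continuous_cos_affine (c d : R) : continuous (fun w : R => cos (c * w + d)).
Proof. exact: (is_derive_continuous (is_derive_cos_affine c d)). Qed.

Lemma continuous_sin_affine (c d : R) : continuous (fun w : R => sin (c * w + d)).
Proof. exact: (is_derive_continuous (is_derive_sin_affine c d)). Qed.

Lemma integrable_itv (f : R -> R) a b : continuous f ->
  mu.-integrable `[a, b] (EFin \o f).
Proof.
move=> cf; apply: continuous_compact_integrable; first exact: segment_compact.
exact: continuous_subspaceT.
Qed.

Lemma is_derive_LR (F f : R -> R) a b : (forall x : R, is_derive x 1 F (f x)) ->
  derivable_oo_LRcontinuous F a b /\ {in `]a, b[, derive1 F =1 f}.
Proof.
move=> dF; have cF := is_derive_continuous dF.
split; first split.
- by move=> x _; case: (dF x).
- by apply: cvg_at_right_filter; exact: cF.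
- by apply: cvg_at_left_filter; exact: cF.
- by move=> x _; rewrite derive1E; case: (dF x).
Qed.

Lemma Rintegral_FTC (F f : R -> R) a b : a <= b ->
  (forall x : R, is_derive x 1 F (f x)) -> continuous f ->
  \int[mu]_(x in `[a, b]) f x = F b - F a.
Proof.
rewrite le_eqVlt => /predU1P[->|ab] dF cf.
  by rewrite set_itv1 Rintegral_set1 subrr.
have [? ?] := is_derive_LR a b dF.
by rewrite /Rintegral (@continuous_FTC2 _ f F)//; exact: continuous_subspaceT.
Qed.

Lemma Rintegral_parts (F f G g : R -> R) a b : a <= b ->
  (forall x : R, is_derive x 1 F (f x)) -> continuous f ->
  (forall x : R, is_derive x 1 G (g x)) -> continuous g ->
  \int[mu]_(x in `[a, b]) (F x * g x) =
  F b * G b - F a * G a - \int[mu]_(x in `[a, b]) (f x * G x).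
Proof.
rewrite le_eqVlt => /predU1P[->|ab] dF cf dG cg.
  by rewrite set_itv1 !Rintegral_set1 subrr subr0.
have [? ?] := is_derive_LR a b dF.
have [? ?] := is_derive_LR a b dG.
by apply: Rintegration_by_parts => //; exact: continuous_subspaceT.
Qed.

Lemma Rintegral_itv_cat (f : R -> R) (a b c : R) : a <= c -> c <= b ->
  mu.-integrable `[a, b] (EFin \o f) ->
  \int[mu]_(x in `[a, b]) f x = \int[mu]_(x in `[a, c]) f x + \int[mu]_(x in `[c, b]) f x.
Proof.
move=> ac cb fi.
rewrite -(Rintegral_itv_obnd_cbnd (r := c)); last first.
  by apply: integrableS fi => //; apply: subset_itv; rewrite ?bnd_simp.
by rewrite -(@Rintegral_itvB _ _ (BLeft a) (BRight b) c)// addrC subrK.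
Qed.

(** The half-lengths are multiples of p so that the segments are unions of
    cells of length p. *)
Lemma cvg_Rintegral_itv (f : R -> R) (p : R) : 0 < p -> L1 f ->
  \int[mu]_(x in `[- (p * n%:R), p * n%:R]) f x @[n --> \oo] --> \int[mu]_x f x.
Proof.
move=> p0 fi.
under eq_fun do rewrite Rintegral_mkcond.
have mf := L1_measurable fi.
apply: (@Rintegral_dominated _ (fun n => f \_ `[- (p * n%:R), p * n%:R]) f (fun x => `|f x|)) => //.
- by move=> n; apply/(measurable_restrictT f) => //; exact: measurable_funTS.
- move=> x; apply: cvg_near_cst.
  near=> n; rewrite patchE ifT// inE/= in_itv/= -ler_norml.
  rewrite -ler_pdivrMl//; near: n; exact: nbhs_infty_ger.
- exact: L1_norm.
- move=> n x; rewrite patchE; case: ifPn => // _; by rewrite normr0.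
Unshelve. all: by end_near. Qed.

End calculus.

(** * The Poisson kernel *)
Section poisson.
Context {R : realType}.
Local Notation mu := (@lebesgue_measure R).
Local Notation L1 f := (mu.-integrable setT (EFin \o f)).

(** The Fourier transform of exp(- e |w|); it is a dilation of the kernel with
    e = 1, and only that kernel is integrated. *)
Definition poisson (e u : R) : R := 2 * e / (e ^+ 2 + u ^+ 2).

Lemma poisson_ge0 (e u : R) : 0 <= e -> 0 <= poisson e u.
Proof. by move=> e0; rewrite divr_ge0 ?mulr_ge0 ?addr_ge0 ?sqr_ge0. Qed.

Lemma continuous_poisson (e : R) : 0 < e -> continuous (poisson e).
Proof.
move=> e0 x; apply: cvgM; first exact: cvg_cst.
apply: cvgV; first by rewrite gt_eqF// ltr_pwDl ?sqr_ge0// exprn_gt0.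
by apply: cvgD; [exact: cvg_cst|exact: exprn_continuous].
Qed.

Lemma measurable_poisson (e : R) : 0 < e -> measurable_fun setT (poisson e).
Proof. by move=> e0; apply: continuous_measurable_fun; exact: continuous_poisson. Qed.

(** An antiderivative is 2 atan, and the kernel is even. *)
Lemma integral_poisson1 : L1 (@poisson 1) /\ \int[mu]_u poisson 1 u = 2 * pi.
Proof.
have p0 x : 0 <= poisson 1 x by exact: poisson_ge0.
have E : (\int[mu]_u (poisson 1 u)%:E = (2 * pi)%:E)%E.
  rewrite ge0_symfun_integralT//; last 2 first.
  - exact: (continuous_poisson ltr01).
  - by move=> x; rewrite /poisson/= sqrrN.
  rewrite -set_itvcy.
  have dat (x : R) : is_derive x 1 (fun x : R => 2 * atan x) (poisson 1 x).
    have -> : (fun x : R => 2 * atan x) = 2 \*: (@atan R) by [].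
    by apply: is_derive_eq; rewrite /poisson /GRing.scale/= expr1n mulr1.
  rewrite (@ge0_continuous_FTC2y _ _ (fun x => 2 * atan x) _ pi)//.
  - by rewrite atan0 mulr0 sube0 EFinM.
  - by apply: continuous_subspaceT; exact: (continuous_poisson ltr01).
  - rewrite -[X in _ --> X](mulfVK (_ : 2 != 0)) //.
    by rewrite mulrC; apply: cvgM; [exact: cvg_cst|exact: cvgy_atan].
  - by apply: cvg_at_right_filter; exact: (is_derive_continuous dat).
  - by move=> x _; rewrite derive1E; case: (dat x).
split; last by rewrite /Rintegral E.
apply/integrableP; split.
  apply/measurable_EFinP; exact: (measurable_poisson ltr01).
under eq_integral do rewrite /= ger0_norm//.
by rewrite E ltry.
Qed.

End poisson.

(** * The transform of exp(- e |w|) *)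
Section damping.
Context {R : realType}.
Local Notation mu := (@lebesgue_measure R).
Local Notation L1 f := (mu.-integrable setT (EFin \o f)).

Definition damp (e w : R) : R := expR (- (e * `|w|)).

Lemma damp_ge0 (e w : R) : 0 <= damp e w.
Proof. exact: expR_ge0. Qed.

Lemma damp_le1 (e w : R) : 0 <= e -> damp e w <= 1.
Proof. by move=> e0; rewrite /damp -expR0 ler_expR oppr_le0 mulr_ge0. Qed.

Lemma measurable_damp (e : R) : measurable_fun setT (damp e).
Proof.
apply: measurableT_comp => //; apply: measurableT_comp => //.
by apply: measurable_funM => //.
Qed.

(** Dominated by a Poisson kernel, by exp(y) >= (1 + y / 2)^2 >= (1 + y^2) / 4. *)
Lemma damp_integrable (e : R) : 0 < e -> L1 (damp e).
Proof.
move=> e0; apply: (@L1_le _ _ (fun w => 2 * poisson 1 (e * w + 0))).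
- exact: measurable_damp.
- apply: L1Z; apply: (integrable_affine 0 e0); exact: (integral_poisson1).1.
move=> w; rewrite ger0_norm ?damp_ge0// /damp /poisson addr0 expr1n mulr1.
set y := e * `|w|; have -> : (e * w) ^+ 2 = y ^+ 2.
  by rewrite /y !exprMn real_normK ?num_real.
have y0 : 0 <= y by rewrite mulr_ge0// ltW.
rewrite expRN mulrA ler_pdivlMr ?ltr_pwDl ?sqr_ge0//.
rewrite mulrC ler_pdivrMr ?expR_gt0//.
have h := expR_ge1Dx (y / 2).
have -> : expR y = expR (y / 2) ^+ 2 by rewrite -expRM_natr mulfVK.
have : (1 + y / 2) ^+ 2 <= expR (y / 2) ^+ 2.
  by rewrite lerXn2r ?nnegrE ?expR_ge0// addr_ge0// divr_ge0.
by nra.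
Qed.

(** Explicit antiderivatives on the two half-lines; their values at the ends of
    [-n, n] tend to 0 with exp(- e n). *)
Lemma integral_damp_cos (e u : R) : 0 < e ->
  \int[mu]_w (damp e w * cos (u * w)) = poisson e u.
Proof.
move=> e0.
have mc : measurable_fun setT (fun w : R => cos (u * w)).
  apply: continuous_measurable_fun; have := @continuous_cos_affine R u 0.
  by under eq_fun do rewrite addr0.
have fi : L1 (fun w => damp e w * cos (u * w)).
  under eq_fun do rewrite mulrC.
  by apply: (L1M_bounded mc _ (damp_integrable e0)) => w; exact: cos_max.
have lim1 := cvg_Rintegral_itv ltr01 fi.
suff lim2 : \int[mu]_(w in `[- (1 * n%:R), 1 * n%:R]) (damp e w * cos (u * w))
    @[n --> \oo] --> poisson e u by exact: (cvg_unique (@Rhausdorff R) lim1 lim2).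
set D := e ^+ 2 + u ^+ 2.
have D0 : 0 < D by rewrite ltr_pwDl ?sqr_ge0// exprn_gt0.
(* antiderivatives on the two half-lines, one for each sign s of w *)
pose F (s w : R) := expR (- s * e * w + 0) * (u * sin (u * w + 0) - s * e * cos (u * w + 0)) / D.
have dF s : s ^+ 2 = 1 -> forall w : R,
    is_derive w 1 (F s) (expR (- s * e * w + 0) * cos (u * w + 0)).
  move=> s2 w.
  have de := is_derive_expR_affine (- s * e) 0 w.
  have ds := is_derive_sin_affine u 0 w.
  have dc := is_derive_cos_affine u 0 w.
  have -> : F s = (fun w => expR (- s * e * w + 0)) *
     (u \*: (fun w => sin (u * w + 0)) - (s * e) \*: (fun w => cos (u * w + 0))) * cst D^-1.
    by apply/funext => x.
  apply: is_derive_eq; rewrite /GRing.scale/= !fctE/=.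
  have Dn0 : D != 0 by rewrite gt_eqF.
  rewrite /cst /= mulr0 add0r.
  apply: (mulfI Dn0); rewrite mulrA divff// mul1r /D.
  rewrite -[e ^+ 2]mul1r -s2 /GRing.scale/=; ring.
have cf (s : R) : continuous (fun w => expR (- s * e * w + 0) * cos (u * w + 0)).
  move=> w; apply: cvgM; last exact: continuous_cos_affine.
  exact: (is_derive_continuous (is_derive_expR_affine (- s * e) 0)).
have Fbound (s w : R) : s ^+ 2 = 1 ->
    `|F s w| <= expR (- s * e * w) * ((`|u| + e) / D).
  move=> s2; rewrite /F addr0 !normrM -mulrA (ger0_norm (expR_ge0 _)).
  rewrite ler_wpM2l ?expR_ge0// (@ger0_norm _ D^-1) ?invr_ge0 ?(ltW D0)//.
  rewrite ler_wpM2r ?invr_ge0 ?(ltW D0)// (le_trans (ler_normB _ _))// !normrM.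
  have s1 : `|s| = 1.
    by apply/eqP; rewrite -(@pexpr_eq1 _ _ 2)// real_normK ?num_real// s2.
  rewrite s1 mul1r (gtr0_norm e0) lerD// ler_piMr ?normr_ge0 ?(ltW e0)//.
  - exact: sin_max.
  - exact: cos_max.
have E n : \int[mu]_(w in `[- (1 * n%:R), 1 * n%:R]) (damp e w * cos (u * w)) =
    poisson e u + (F 1 n%:R - F (-1) (- n%:R)).
  rewrite mul1r (@Rintegral_itv_cat _ _ _ _ 0) ?oppr_le0//; last exact: integrableS fi.
  have -> : \int[mu]_(w in `[- n%:R, 0]) (damp e w * cos (u * w)) = F (-1) 0 - F (-1) (- n%:R).
    rewrite -(Rintegral_FTC _ (dF (-1) _))// ?oppr_le0// ?sqrrN ?expr1n//.
    apply: eq_Rintegral => w; rewrite inE/= in_itv/= => /andP[_ w0].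
    by rewrite /damp ler0_norm// !addr0 opprK mul1r mulrN opprK.
  have -> : \int[mu]_(w in `[0, n%:R]) (damp e w * cos (u * w)) = F 1 n%:R - F 1 0.
    rewrite -(Rintegral_FTC _ (dF 1 _))// ?expr1n//.
    apply: eq_Rintegral => w; rewrite inE/= in_itv/= => /andP[w0 _].
    by rewrite /damp ger0_norm// !addr0 mulN1r mulNr.
  have -> : poisson e u = F (-1) 0 - F 1 0.
    by rewrite /F /poisson !mulr0 !addr0 sin0 cos0 expR0 -/D; ring.
  ring.
suff : poisson e u + (F 1 n%:R - F (-1) (- n%:R)) @[n --> \oo] --> poisson e u + 0.
  rewrite addr0; apply: cvg_trans; apply: near_eq_cvg.
  by apply: nearW => n /=; rewrite E.
apply: cvgD; first exact: cvg_cst.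
apply/norm_cvg0P.
apply: (@squeeze_cvgr _ _ _ _ (cst 0) (fun n => 2 * ((`|u| + e) / D) * expR (- (e * n%:R)))).
- apply: nearW => n /=; rewrite normr_ge0/= (le_trans (ler_normB _ _))//.
  have := Fbound 1 n%:R (expr1n _ _); have := Fbound (-1) (- n%:R).
  rewrite sqrrN expr1n => /(_ erefl); rewrite opprK mul1r mulrN mulN1r mulNr.
  by move=> h1 h2; rewrite (le_trans (lerD h2 h1))// -mulrDl mulrC -mulr2n -mulr_natl; nra.
- exact: cvg_cst.
- rewrite -[X in _ --> X](mulr0 (2 * ((`|u| + e) / D))).
  apply: cvgM; first exact: cvg_cst.
  apply: (cvg_comp _ _ _ (@cvgr_expR R)).
  apply/cvgryPge => A; near=> n; rewrite -ler_pdivrMl//; near: n; exact: nbhs_infty_ger.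
Unshelve. all: by end_near. Qed.

End damping.

(** * Continuity of correlations at the origin *)
Section correlation.
Context {R : realType}.
Local Notation mu := (@lebesgue_measure R).
Local Notation L1 f := (mu.-integrable setT (EFin \o f)).

Lemma L1_shift (f : R -> R) (u : R) : L1 f -> L1 (fun x => f (x + u)).
Proof.
move=> fi; have := integrable_affine u ltr01 fi.
by under [X in EFin \o X]eq_fun do rewrite mul1r.
Qed.

Lemma Rintegral_shift (f : R -> R) (u : R) : L1 f ->
  \int[mu]_x f (x + u) = \int[mu]_x f x.
Proof.
move=> fi; have := Rintegral_affine u ltr01 fi; rewrite invr1 mul1r => <-.
by apply: eq_Rintegral => x _; rewrite mul1r.
Qed.

Lemma measurable_shift (f : R -> R) (u : R) : measurable_fun setT f ->
  measurable_fun setT (fun x : R => f (x + u)).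
Proof.
move=> mf; have := measurableT_comp mf (measurable_affine 1 u).
by apply: eq_measurable_fun => x _ /=; rewrite mul1r.
Qed.

Lemma L2_shift (f : R -> R) (u : R) : L2 f -> L2 (fun x => f (x + u)).
Proof.
move=> fL; apply/L2P; split; first by apply: measurable_shift; exact: L2_measurable.
exact: (L1_shift u (L2_sqr fL)).
Qed.

Lemma continuous_bounded_itv (h : R -> R) (r : R) : continuous h ->
  exists2 M, 0 <= M & forall x, `|x| <= r -> `|h x| <= M.
Proof.
move=> ch.
have cptA : compact (`[- r, r] : set R) by exact: segment_compact.
have ctsfA : {within `[- r, r], continuous h} by exact: continuous_subspaceT.
have /compact_bounded[M [_ mrt]] := continuous_compact ctsfA cptA.
exists (`|M| + 1); first by rewrite addr_ge0.
move=> x xr; apply: (mrt (`|M| + 1)); first by rewrite ltr_pwDr// ler_norm.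
by exists x => //=; rewrite in_itv/= -ler_norml.
Qed.

Lemma L2_bounded_approx (f : R -> R) (eps : R) : L2 f -> 0 < eps ->
  exists k : nat, \int[mu]_x ((f x - (if `|f x| <= k%:R then f x else 0)) ^+ 2) < eps.
Proof.
move=> fL e0; pose g k x := (f x - (if `|f x| <= k%:R then f x else 0)) ^+ 2.
have mf := L2_measurable fL.
have mg k : measurable_fun setT (g k).
  apply: measurable_funX; apply: measurable_funB => //.
  apply: measurable_fun_ifT => //.
  by apply: measurable_fun_ler => //; exact: measurableT_comp.
have : \int[mu]_x g k x @[k --> \oo] --> \int[mu]_x (cst 0 x : R).
  apply: (@Rintegral_dominated _ g (cst 0) (fun x => f x ^+ 2)) => //.
  - move=> x; apply: cvg_near_cst; near=> k; rewrite /g ifT ?subrr ?expr0n//.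
    near: k; exact: nbhs_infty_ger.
  - exact: L2_sqr.
  - move=> k x; rewrite /g ger0_norm ?sqr_ge0//.
    by case: ifPn => _; rewrite ?subr0// subrr expr0n/= sqr_ge0.
rewrite Rintegral_cst// mul0r => /cvgrPdist_lt/(_ _ e0)[k _ /(_ k)]/=.
move=> /(_ (leqnn k)) h; exists k; rewrite sub0r normrN in h.
by rewrite (le_lt_trans _ h)// ler_norm.
Unshelve. all: by end_near. Qed.

Lemma L2_integrable_itv (g : R -> R) (r : R) : L2 g ->
  mu.-integrable `[- r, r] (EFin \o g).
Proof.
move=> gL; have mg := L2_measurable gL.
have gi : mu.-integrable `[- r, r] (EFin \o (fun x => 1 + g x ^+ 2)).
  have : mu.-integrable `[- r, r] ((EFin \o (fun=> 1%R : R)) \+ (EFin \o (fun x => g x ^+ 2)%R))%E.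
    apply: integrableD => //.
    - exact: (@integrable_itv _ (cst 1) (-r) r (@cst_continuous _ _ _)).
    - by apply: integrableS (L2_sqr gL).
  by apply: eq_integrable.
apply: (le_integrable _ _ _ gi) => //.
  by apply/measurable_EFinP; exact: measurable_funTS.
move=> x _ /=; rewrite lee_fin [leRHS]ger0_norm ?addr_ge0 ?sqr_ge0//.
by rewrite -[g x ^+ 2]real_normK ?num_real//; have := normr_ge0 (g x); nra.
Qed.

Lemma integrable_patch (f : R -> R) (E : set R) : measurable E ->
  mu.-integrable E (EFin \o f) -> L1 (f \_ E).
Proof. by move=> mE fi; have := (@integrable_mkcond _ _ _ mu E (EFin \o f) mE).1 fi; rewrite restrict_EFin. Qed.

Lemma L2_L1_compact (f : R -> R) (r : R) : L2 f ->
  (forall x, r < `|x| -> f x = 0) -> L1 f.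
Proof.
move=> fL fr; suff -> : f = f \_ `[- r, r].
  by apply: integrable_patch => //; exact: L2_integrable_itv.
apply/funext => x; rewrite patchE; case: ifPn => //.
by rewrite notin_setE/= in_itv/= -ler_norml => /negP; rewrite -ltNge => /fr.
Qed.

Lemma le_dist_approx (e a1 a2 a3 a4 a5 a6 : R) :
  `|a3 - a4| <= e / 4 -> `|a5| <= e / 8 -> `|a6| <= e / 8 ->
  `|a1 - (a3 + a5)| <= e / 4 -> `|a2 - (a4 + a6)| <= e / 4 -> `|a1 - a2| <= e.
Proof.
rewrite !ler_norml => /andP[? ?] /andP[? ?] /andP[? ?] /andP[? ?] /andP[? ?].
by apply/andP; split; lra.
Qed.

(** Translations are continuous in L^2, in the weak form needed here. Up to
    eps, f may be replaced by a bounded function b vanishing where f does, by the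
    Cauchy-Schwarz inequality; then g by a continuous h, as b is bounded; and
    for h the convergence is dominated. *)
Lemma correlation_cvg (f g : R -> R) (r B : R) (u_ : nat -> R) : L2 f -> L2 g ->
  (forall x, r < `|x| -> f x = 0) -> (forall n, `|u_ n| <= B) ->
  u_ n @[n --> \oo] --> 0 ->
  \int[mu]_x (f x * g (x + u_ n)) @[n --> \oo] --> \int[mu]_x (f x * g x).
Proof.
move=> fL gL fr uB u0; apply/cvgrPdist_le => eps e0.
have mf := L2_measurable fL; have mg := L2_measurable gL.
pose G := Num.sqrt (\int[mu]_x (g x ^+ 2)).
have G0 : 0 <= G by exact: sqrtr_ge0.
pose d := eps / (4 * (G + 1)).
have G1 : 0 < 4 * (G + 1) by rewrite mulr_gt0// ltr_wpDl.
have d0 : 0 < d by rewrite divr_gt0.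
have [k kd] := L2_bounded_approx fL (exprn_gt0 2 d0).
(* f is replaced by the bounded function b, at the cost step1 *)
pose b x := if `|f x| <= k%:R then f x else 0.
have mb : measurable_fun setT b.
  apply: measurable_fun_ifT => //.
  by apply: measurable_fun_ler => //; exact: measurableT_comp.
have bk x : `|b x| <= k%:R by rewrite /b; case: ifPn => //; rewrite normr0.
have br x : r < `|x| -> b x = 0 by move=> rx; rewrite /b fr// if_same.
have bL : L2 b.
  by apply: (L2_le mb fL) => x; rewrite /b; case: ifPn => // _; rewrite normr0.
have step1 u : `|\int[mu]_x (f x * g (x + u)) - \int[mu]_x (b x * g (x + u))| <= eps / 4.
  have gsL := L2_shift u gL.
  rewrite -RintegralB ?L2_mul//.
  under eq_Rintegral do rewrite -mulrBl.
  rewrite (le_trans (cauchy_schwarz (L2B fL bL) gsL))//.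
  rewrite (Rintegral_shift u (L2_sqr gL)) -/G.
  apply: (@le_trans _ _ (d * G)).
    rewrite ler_wpM2r// -[leRHS]ger0_norm ?(ltW d0)// -sqrtr_sqr ler_sqrt ?sqr_ge0//.
    exact: ltW.
  by rewrite /d mulrAC ler_pdivrMr//; nra.
(* E contains the translates of the support of f by all u_ n; on E, g is
   replaced by the continuous function h, at the cost step2 *)
pose E : set R := `[- (r + B), r + B]%classic.
have mE : measurable E by exact: measurable_itv.
have [h_ [ch_ ih_ gh_]] := @approximation_continuous_integrable _ E g mE
  (compact_finite_measure (@segment_compact _ _ _)) (L2_integrable_itv (r + B) gL).
have e2 : 0 < eps / (8 * (k%:R + 1)) by rewrite divr_gt0// mulr_gt0// ltr_wpDl.
have /cvgrPdist_lt/(_ _ e2)[j _ /(_ j (leqnn j))] :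
    \int[mu]_(z in E) `|g z - h_ n z| @[n --> \oo] --> 0 by exact: (fine_cvg gh_).
rewrite /= sub0r normrN.
set h := h_ j; set e' := eps / _ => hj.
have ch : continuous h by exact: ch_.
pose q := (fun x => g x - h x) \_ E.
have qi : L1 q.
  apply: integrable_patch => //.
  by apply: (integrableB _ (L2_integrable_itv (r + B) gL) (ih_ j)); exact: measurable_itv.
have q_small : \int[mu]_x `|q x| <= e'.
  apply: (le_trans _ (ltW hj)); rewrite (le_trans _ (ler_norm _))//.
  rewrite [leRHS]Rintegral_mkcond.
  rewrite le_eqVlt; apply/orP; left; apply/eqP; apply: eq_Rintegral => x _.
  by rewrite /q !patchE; case: ifPn => //; rewrite normr0.
have bq u : L1 (fun x => b x * q (x + u)).
  by apply: (L1M_bounded mb bk); exact: L1_shift.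
have step2 u : `|\int[mu]_x (b x * q (x + u))| <= eps / 8.
  rewrite (le_trans (le_normr_Rintegral _ _))//.
  apply: (@le_trans _ _ (\int[mu]_x (k%:R * `|q (x + u)|))).
    apply: le_Rintegral => //.
    - by apply: L1_norm.
    - by apply: L1Z; apply: L1_norm; exact: L1_shift.
    - by move=> x _; rewrite normrM ler_wpM2r.
  rewrite RintegralZl//; last by apply: L1_norm; exact: L1_shift.
  rewrite (Rintegral_shift u (L1_norm qi)).
  apply: (@le_trans _ _ (k%:R * e')); first by rewrite ler_wpM2l.
  have k0 : 0 <= k%:R :> R by [].
  have k1 : 0 < 8 * (k%:R + 1) :> R by rewrite mulr_gt0// ltr_wpDl.
  rewrite /e' mulrA ler_pdivrMr//; nra.
have bgE u : `|u| <= B -> \int[mu]_x (b x * g (x + u)) =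
    \int[mu]_x (b x * h (x + u)) + \int[mu]_x (b x * q (x + u)).
  move=> uB'.
  have E1 x : b x * h (x + u) = b x * g (x + u) - b x * q (x + u).
    have [rx|xr] := ltP r `|x|; first by rewrite br// !mul0r subrr.
    rewrite /q patchE ifT; first by ring.
    by rewrite inE /E/= in_itv/= -ler_norml (le_trans (ler_normD _ _))// lerD.
  under [X in _ = X + _]eq_Rintegral do rewrite E1.
  by rewrite RintegralB ?subrK//; apply: L2_mul => //; exact: L2_shift.
have [M M0 hM] := continuous_bounded_itv (r + B) ch.
have B0 : 0 <= B by rewrite (le_trans _ (uB 0%N)).
have /cvgrPdist_le H : \int[mu]_x (b x * h (x + u_ n)) @[n --> \oo] --> \int[mu]_x (b x * h x).
  apply: (@Rintegral_dominated _ _ _ (fun x => M * `|b x|)).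
  - move=> n; apply: measurable_funM => //; apply: measurable_shift.
    exact: continuous_measurable_fun.
  - by apply: measurable_funM => //; exact: continuous_measurable_fun.
  - move=> x; apply: cvgM; first exact: cvg_cst.
    apply: (@continuous_cvg _ _ _ _ _ _ h); first exact: ch.
    by rewrite -[X in _ --> X]addr0; apply: cvgD; [exact: cvg_cst|exact: u0].
  - by apply: L1Z; apply: L1_norm; exact: (L2_L1_compact bL br).
  - move=> n x; rewrite normrM mulrC.
    have [rx|xr] := ltP r `|x|; first by rewrite br// normr0 !mulr0.
    by rewrite ler_wpM2r// hM// (le_trans (ler_normD _ _))// lerD.
have e4 : 0 < eps / 4 by rewrite divr_gt0.
near=> n.
have Hn : `|\int[mu]_x (b x * h x) - \int[mu]_x (b x * h (x + u_ n))| <= eps / 4.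
  by near: n; exact: H.
have := bgE (u_ n) (uB n); have := bgE 0; rewrite normr0 => /(_ B0).
under eq_Rintegral do rewrite addr0.
under [X in _ = X + _ -> _]eq_Rintegral do rewrite addr0.
under [X in _ = _ + X -> _]eq_Rintegral do rewrite addr0.
move=> E0 En.
have := step1 (u_ n); have := step1 0.
under eq_Rintegral do rewrite addr0.
under [X in `|_ - X|]eq_Rintegral do rewrite addr0.
have := step2 (u_ n); have := step2 0.
under eq_Rintegral do rewrite addr0.
rewrite En E0.
exact: (le_dist_approx Hn).
Unshelve. all: by end_near. Qed.

End correlation.

(** * Parseval's identity for compactly supported functions *)
Section parseval.
Context {R : realType}.
Local Notation mu := (@lebesgue_measure R).
Local Notation L1 f := (mu.-integrable setT (EFin \o f)).

(** The Fourier transform of a real f is [costr f - i sintr f]; working with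
    these two real functions keeps complex-valued integrals out of the proof. *)
Definition costr (f : R -> R) (w : R) : R := \int[mu]_x (f x * cos (w * x)).
Definition sintr (f : R -> R) (w : R) : R := \int[mu]_x (f x * sin (w * x)).

Lemma measurable_cos : measurable_fun setT (@cos R).
Proof. by apply: continuous_measurable_fun; exact: continuous_cos. Qed.

Lemma measurable_sin : measurable_fun setT (@sin R).
Proof. by apply: continuous_measurable_fun; exact: continuous_sin. Qed.

Lemma measurable_cosM : measurable_fun setT (fun z : R * R => cos (z.1 * z.2)).
Proof.
apply: (measurableT_comp measurable_cos).
exact: measurable_funM.
Qed.

Lemma measurable_sinM : measurable_fun setT (fun z : R * R => sin (z.1 * z.2)).
Proof.
apply: (measurableT_comp measurable_sin).
exact: measurable_funM.
Qed.

Lemma L1_cos (f : R -> R) (w : R) : L1 f -> L1 (fun x => f x * cos (w * x)).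
Proof.
move=> fi; under eq_fun do rewrite mulrC; apply: (@L1M_bounded _ _ _ 1) => //.
  exact: (measurableT_comp measurable_cosM (pair1_measurable w)).
by move=> x; exact: cos_max.
Qed.

Lemma L1_sin (f : R -> R) (w : R) : L1 f -> L1 (fun x => f x * sin (w * x)).
Proof.
move=> fi; under eq_fun do rewrite mulrC; apply: (@L1M_bounded _ _ _ 1) => //.
  exact: (measurableT_comp measurable_sinM (pair1_measurable w)).
by move=> x; exact: sin_max.
Qed.

Lemma costr_bound (f : R -> R) (w : R) : L1 f -> `|costr f w| <= \int[mu]_x `|f x|.
Proof.
move=> fi; rewrite (le_trans (le_normr_Rintegral _ (L1_cos w fi)))//.
apply: le_Rintegral => //; [exact: (L1_norm (L1_cos w fi))|exact: L1_norm|].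
by move=> x _; rewrite normrM ler_piMr//; exact: cos_max.
Qed.

Lemma sintr_bound (f : R -> R) (w : R) : L1 f -> `|sintr f w| <= \int[mu]_x `|f x|.
Proof.
move=> fi; rewrite (le_trans (le_normr_Rintegral _ (L1_sin w fi)))//.
apply: le_Rintegral => //; [exact: (L1_norm (L1_sin w fi))|exact: L1_norm|].
by move=> x _; rewrite normrM ler_piMr//; exact: sin_max.
Qed.

Lemma costr_sintr_translate (g : R -> R) (w x : R) : L1 g ->
  cos (w * x) * costr g w + sin (w * x) * sintr g w =
  \int[mu]_y (g y * cos ((y - x) * w)).
Proof.
move=> gi; rewrite /costr /sintr -!RintegralZl ?L1_cos ?L1_sin//.
rewrite -RintegralD ?L1Z ?L1_cos ?L1_sin//.
apply: eq_Rintegral => y _.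
have -> : (y - x) * w = w * y - w * x by ring.
by rewrite cosB; ring.
Qed.

(** The form in which [Rfubini] takes its domination hypothesis. *)
Lemma section_bound (h : R -> R) (k : R -> R) (c : R) : L1 k ->
  measurable_fun setT h -> (forall x, `|h x| <= k x) -> \int[mu]_x k x <= c ->
  (\int[mu]_x `|h x|%:E <= c%:E)%E.
Proof.
move=> ki mh hk kc; apply: (@le_trans _ _ (\int[mu]_x (k x)%:E)%E).
  apply: ge0_le_integral => //=.
  - by apply/measurable_EFinP; apply: measurableT_comp.
  - exact: (measurable_int _ ki).
  - by move=> x _; rewrite lee_fin.
by rewrite -RintegralE.
Qed.

Lemma trig_combination_bound (c t u v : R) : `|u| <= c -> `|v| <= c ->
  `|cos t * u + sin t * v| <= 2 * c.
Proof.
move=> uc vc; rewrite (le_trans (ler_normD _ _))// !normrM mulrDl mul1r lerD//.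
  by rewrite -[leRHS]mul1r ler_pM//; exact: cos_max.
by rewrite -[leRHS]mul1r ler_pM//; exact: sin_max.
Qed.

(** Fubini for the transform of f against arbitrary bounded cg and sg, which
    later stand for [costr g] and [sintr g]. Without the damping factor the
    integrand would not be integrable on the plane. *)
Lemma damped_transform_swap (f cg sg : R -> R) (c e : R) : L1 f -> 0 < e ->
  measurable_fun setT cg -> measurable_fun setT sg ->
  (forall w, `|cg w| <= c) -> (forall w, `|sg w| <= c) ->
  \int[mu]_w (damp e w * (costr f w * cg w + sintr f w * sg w)) =
  \int[mu]_x (f x * \int[mu]_w (damp e w * (cos (w * x) * cg w + sin (w * x) * sg w))).
Proof.
move=> fi e0 mcg msg cgc sgc; have mf := L1_measurable fi.
pose F (z : R * R) := damp e z.1 * f z.2 *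
  (cos (z.1 * z.2) * cg z.1 + sin (z.1 * z.2) * sg z.1).
have mF : measurable_fun setT F.
  apply: measurable_funM.
    apply: measurable_funM; first exact: (measurableT_comp (measurable_damp e) measurable_fst).
    exact: (measurableT_comp mf measurable_snd).
  apply: measurable_funD; apply: measurable_funM.
  - exact: measurable_cosM.
  - exact: (measurableT_comp mcg measurable_fst).
  - exact: measurable_sinM.
  - exact: (measurableT_comp msg measurable_fst).
have Fb w x : `|F (w, x)| <= damp e w * (2 * c) * `|f x|.
  rewrite /F/= normrM normrM (ger0_norm (damp_ge0 _ _)) mulrAC.
  by rewrite ler_wpM2r// ler_wpM2l ?damp_ge0// trig_combination_bound.
have Fsec x : measurable_fun setT (fun y => F (x, y)).
  exact: (measurableT_comp mF (pair1_measurable x)).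
pose G w := damp e w * (2 * c) * \int[mu]_x `|f x|.
have Gi : L1 G.
  rewrite /G; under eq_fun do rewrite -mulrA mulrC.
  by apply: L1Z; exact: damp_integrable.
have Fsb w : (\int[mu]_y `|F (w, y)|%:E <= (G w)%:E)%E.
  apply: (section_bound _ (Fsec w) (Fb w)); first by apply: L1Z; exact: L1_norm.
  by rewrite RintegralZl//; exact: L1_norm.
transitivity (\int[mu]_w \int[mu]_x F (w, x)).
  clear Fsb Gi G Fsec Fb mF; apply: eq_Rintegral => w _; rewrite /F/=.
  under [RHS]eq_Rintegral do rewrite -mulrA.
  have fcg : L1 (fun x => f x * cos (w * x) * cg w).
    by under eq_fun do rewrite mulrC; exact: (L1Z _ (L1_cos w fi)).
  have fsg : L1 (fun x => f x * sin (w * x) * sg w).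
    by under eq_fun do rewrite mulrC; exact: (L1Z _ (L1_sin w fi)).
  have E x : f x * (cos (w * x) * cg w + sin (w * x) * sg w) =
    f x * cos (w * x) * cg w + f x * sin (w * x) * sg w by ring.
  under [RHS]eq_Rintegral do rewrite E.
  rewrite RintegralZl; [|by []|exact: (L1D fcg fsg)].
  congr (_ * _); rewrite RintegralD; [|by []|exact: fcg|exact: fsg].
  rewrite RintegralZr; [|by []|exact: (L1_cos w fi)].
  by rewrite RintegralZr; [|by []|exact: (L1_sin w fi)].
rewrite (Rfubini mF Gi Fsb).1; clear Fsb Gi G Fsec Fb mF.
apply: eq_Rintegral => x _; rewrite /F/=.
under eq_Rintegral do rewrite -mulrA mulrCA.
rewrite RintegralZl; [by []|by []|].
apply: (@L1_le _ _ (fun w => damp e w * (2 * c))).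
- apply: measurable_funM; first exact: measurable_damp.
  apply: measurable_funD; apply: measurable_funM => //.
  + exact: (measurableT_comp measurable_cosM (pair2_measurable x)).
  + exact: (measurableT_comp measurable_sinM (pair2_measurable x)).
- by under eq_fun do rewrite mulrC; apply: L1Z; exact: damp_integrable.
- move=> w; rewrite normrM (ger0_norm (damp_ge0 _ _)).
  by rewrite ler_wpM2l ?damp_ge0// trig_combination_bound.
Qed.

Section damped.
Variables (g : R -> R) (e : R).
Hypotheses (gi : L1 g) (e0 : 0 < e).

Let mg : measurable_fun setT g. Proof. exact: L1_measurable. Qed.

(** Inverting the damped transform of g yields its Poisson integral, by
    [integral_damp_cos] under the integral sign. The substitution y = x + e v
    moves the dependence on e into the argument of g. *)
Lemma damped_transform_poisson (x : R) :
  \int[mu]_w (damp e w * (cos (w * x) * costr g w + sin (w * x) * sintr g w)) =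
  \int[mu]_v (poisson 1 v * g (x + e * v)).
Proof.
have pb y : `|poisson e (y - x)| <= 2 / e.
  rewrite ger0_norm ?poisson_ge0 ?(ltW e0)// /poisson.
  rewrite ler_pdivrMr ?ltr_pwDl ?sqr_ge0 ?exprn_gt0// mulrDr -mulrA expr2 mulKf ?gt_eqF//.
  by rewrite lerDl mulr_ge0 ?sqr_ge0// divr_ge0// ltW.
have pgi : L1 (fun y => poisson e (y - x) * g y).
  apply: (L1M_bounded _ pb gi); apply: (measurable_shift (- x)); exact: measurable_poisson.
pose F (z : R * R) := damp e z.1 * (g z.2 * cos ((z.2 - x) * z.1)).
have mF : measurable_fun setT F.
  apply: measurable_funM; first exact: (measurableT_comp (measurable_damp e) measurable_fst).
  apply: measurable_funM; first exact: (measurableT_comp mg measurable_snd).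
  apply: (measurableT_comp measurable_cos).
  apply: measurable_funM; last exact: measurable_fst.
  exact: measurable_funB.
have Fb w y : `|F (w, y)| <= damp e w * `|g y|.
  rewrite /F/= normrM (ger0_norm (damp_ge0 _ _)) ler_wpM2l ?damp_ge0//.
  by rewrite normrM ler_piMr//; exact: cos_max.
have Fsec w : measurable_fun setT (fun y => F (w, y)).
  exact: (measurableT_comp mF (pair1_measurable w)).
pose G w := damp e w * \int[mu]_x `|g x|.
have Gi : L1 G.
  by rewrite /G; under eq_fun do rewrite mulrC; apply: L1Z; exact: damp_integrable.
have Fsb w : (\int[mu]_y `|F (w, y)|%:E <= (G w)%:E)%E.
  apply: (section_bound _ (Fsec w) (Fb w)); first by apply: L1Z; exact: L1_norm.
  by rewrite RintegralZl//; exact: L1_norm.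
transitivity (\int[mu]_w \int[mu]_y F (w, y)).
  clear Fsb Gi G Fsec Fb mF.
  apply: eq_Rintegral => w _; rewrite /F/= costr_sintr_translate// RintegralZl; [by []|by []|].
  under [X in EFin \o X]eq_fun do rewrite mulrC; apply: (@L1M_bounded _ _ _ 1) => //.
    apply: (measurableT_comp measurable_cos).
    by apply: measurable_funM => //; exact: measurable_funB.
  by move=> y; exact: cos_max.
rewrite (Rfubini mF Gi Fsb).1; clear Fsb Gi G Fsec Fb mF.
transitivity (\int[mu]_y (poisson e (y - x) * g y)).
  apply: eq_Rintegral => y _; rewrite /F/=.
  under eq_Rintegral do rewrite mulrCA.
  rewrite RintegralZl//.
    by rewrite integral_damp_cos// mulrC.
  by apply: L1_cos; exact: damp_integrable.
have := Rintegral_affine x e0 pgi => /(congr1 ( *%R e)).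
rewrite mulrA divff ?gt_eqF// mul1r => <-.
rewrite -RintegralZl//; last exact: (integrable_affine x e0 pgi).
apply: eq_Rintegral => v _; rewrite addrK mulrA [x + _]addrC; congr (_ * _).
rewrite /poisson exprMn expr1n mulr1; have en0 := gt_eqF e0.
have v0 : 1 + v ^+ 2 != 0 by rewrite gt_eqF// ltr_pwDl ?sqr_ge0.
have v1 : e ^+ 2 + e ^+ 2 * v ^+ 2 != 0.
  by rewrite -[X in X + _]mulr1 -mulrDr mulf_neq0// ?expf_neq0// en0.
by rewrite mulrA; apply/eqP; rewrite eqr_div//; apply/eqP; ring.
Qed.

End damped.

Lemma correlation_bound (f g : R -> R) (u : R) : L2 f -> L2 g ->
  (\int[mu]_x `|f x * g (x + u)|%:E <=
   ((\int[mu]_x (f x ^+ 2) + \int[mu]_x (g x ^+ 2)) / 2)%:E)%E.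
Proof.
move=> fL gL; have gsL := L2_shift u gL.
have ki : L1 (fun x => f x ^+ 2 + g (x + u) ^+ 2).
  by apply: L1D; exact: L2_sqr.
have k2i := L1Z (2^-1) ki.
apply: (section_bound k2i).
- by apply: measurable_funM; exact: L2_measurable.
- move=> x; rewrite [leRHS]mulrC ler_pdivlMr// normrM.
  rewrite -[f x ^+ 2]real_normK ?num_real// -[g _ ^+ 2]real_normK ?num_real//.
  by have := sqr_ge0 (`|f x| - `|g (x + u)|); nra.
- rewrite RintegralZl// RintegralD// ?L2_sqr// mulrC.
  by rewrite (Rintegral_shift u (L2_sqr gL)).
Qed.

Lemma poisson_correlation_swap (f g : R -> R) (e : R) : L2 f -> L2 g -> L1 g -> 0 < e ->
  \int[mu]_x (f x * \int[mu]_v (poisson 1 v * g (x + e * v))) =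
  \int[mu]_v (poisson 1 v * \int[mu]_x (f x * g (x + e * v))) /\
  L1 (fun v => poisson 1 v * \int[mu]_x (f x * g (x + e * v))).
Proof.
move=> fL gL gi e0; have mf := L2_measurable fL; have mg := L2_measurable gL.
pose C := (\int[mu]_x (f x ^+ 2) + \int[mu]_x (g x ^+ 2)) / 2.
pose F (z : R * R) := poisson 1 z.1 * (f z.2 * g (z.2 + e * z.1)).
have mp : measurable_fun setT (poisson 1 : R -> R) by exact: (measurable_poisson ltr01).
have mF : measurable_fun setT F.
  apply: measurable_funM; first exact: (measurableT_comp mp measurable_fst).
  apply: measurable_funM; first exact: (measurableT_comp mf measurable_snd).
  apply: (measurableT_comp mg); apply: measurable_funD => //.
  by apply: measurable_funM.
have Fsb v : (\int[mu]_y `|F (v, y)|%:E <= (poisson 1 v * C)%:E)%E.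
  rewrite /F/=; under eq_integral do rewrite normrM (ger0_norm (poisson_ge0 _ ler01)) EFinM.
  rewrite ge0_integralZl//=.
  - by rewrite [leRHS]EFinM; apply: lee_wpmul2l; rewrite ?lee_fin ?poisson_ge0//; exact: correlation_bound.
  - by apply/measurable_EFinP; apply: measurableT_comp => //; apply: measurable_funM => //;
      exact: measurable_shift.
  - by rewrite lee_fin poisson_ge0.
have Gi : L1 (fun v => poisson 1 v * C).
  by under eq_fun do rewrite mulrC; apply: L1Z; exact: (integral_poisson1).1.
have Fin v : \int[mu]_x F (v, x) = poisson 1 v * \int[mu]_x (f x * g (x + e * v)).
  by rewrite /F/= RintegralZl; [by []|by []|apply: L2_mul => //; exact: L2_shift].
split; last first.
  have := Rintegral_section_L1 mF Gi Fsb.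
  by under [X in EFin \o X]eq_fun do rewrite Fin.
transitivity (\int[mu]_v \int[mu]_x F (v, x)); last first.
  by apply: eq_Rintegral => v _; rewrite Fin.
rewrite (Rfubini mF Gi Fsb).1; clear Fsb Gi mF Fin.
apply: eq_Rintegral => x _; rewrite /F/=.
under [RHS]eq_Rintegral do rewrite mulrCA.
rewrite RintegralZl; [by []|by []|].
apply: (@L1M_bounded _ _ _ 2) => //.
- move=> v; rewrite ger0_norm ?poisson_ge0// /poisson expr1n mulr1.
  by rewrite ler_pdivrMr ?ltr_pwDl ?sqr_ge0// mulrDr mulr1 lerDl mulr_ge0 ?sqr_ge0.
- by under [X in EFin \o X]eq_fun do rewrite addrC; exact: (integrable_affine x e0 gi).
Qed.

Lemma harmonic_mul_cvg0 (v : R) : n.+1%:R^-1 * v @[n --> \oo] --> (0 : R).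
Proof. by rewrite -[X in _ --> X](mul0r v); apply: cvgM; [exact: cvg_harmonic|exact: cvg_cst]. Qed.

(** Abel summation of a convergent integral, along e = 1 / (n + 1). *)
Lemma damp_cvg (h : R -> R) : L1 h ->
  \int[mu]_w (damp n.+1%:R^-1 w * h w) @[n --> \oo] --> \int[mu]_w h w.
Proof.
move=> hi; have mh := L1_measurable hi.
apply: (@Rintegral_dominated _ _ _ (fun x => `|h x|)) => //.
- by move=> n; apply: measurable_funM => //; exact: measurable_damp.
- move=> w; rewrite -[X in _ --> X]mul1r; apply: cvgM; last exact: cvg_cst.
  rewrite -[X in _ --> X](@expR0 R); apply: (@continuous_cvg _ _ _ _ _ _ expR); first exact: continuous_expR.
  by rewrite -[X in _ --> X]oppr0; apply: cvgN; exact: harmonic_mul_cvg0.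
- exact: L1_norm.
- move=> n w; rewrite normrM ger0_norm ?damp_ge0// ler_piMl// damp_le1//.
Qed.

(** After damping, both sides of the identity become the average, against the
    Poisson kernel, of the correlation of f and g at e v; as e tends to 0 this
    average tends to 2 pi times the correlation at 0, by [correlation_cvg]. The
    compact support of f is what makes the correlation continuous there. *)
Lemma parseval_compact (f g : R -> R) (r : R) : L2 f -> L2 g ->
  (forall x, r < `|x| -> f x = 0) -> L1 g ->
  L2 (costr f) -> L2 (sintr f) -> L2 (costr g) -> L2 (sintr g) ->
  \int[mu]_w (costr f w * costr g w + sintr f w * sintr g w) =
  2 * pi * \int[mu]_x (f x * g x).
Proof.
move=> fL gL fr gi cfL sfL cgL sgL.
have fi := L2_L1_compact fL fr.
pose e_ n : R := n.+1%:R^-1.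
have e0 n : 0 < e_ n by rewrite invr_gt0.
pose A u := \int[mu]_x (f x * g (x + u)).
have JE n : \int[mu]_w (damp (e_ n) w * (costr f w * costr g w + sintr f w * sintr g w)) =
    \int[mu]_v (poisson 1 v * A (e_ n * v)).
  rewrite (damped_transform_swap fi (e0 n) (L2_measurable cgL) (L2_measurable sgL)
    (fun w => costr_bound w gi) (fun w => sintr_bound w gi)).
  under eq_Rintegral do rewrite (damped_transform_poisson gi (e0 n)).
  exact: (poisson_correlation_swap fL gL gi (e0 n)).1.
have lim1 : \int[mu]_w (damp (e_ n) w * (costr f w * costr g w + sintr f w * sintr g w))
    @[n --> \oo] --> \int[mu]_w (costr f w * costr g w + sintr f w * sintr g w).
  have hi : L1 (fun w => costr f w * costr g w + sintr f w * sintr g w).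
    by apply: L1D; exact: L2_mul.
  exact: damp_cvg hi.
have lim2 : \int[mu]_v (poisson 1 v * A (e_ n * v)) @[n --> \oo] -->
    \int[mu]_v (poisson 1 v * A 0).
  pose C := (\int[mu]_x (f x ^+ 2) + \int[mu]_x (g x ^+ 2)) / 2.
  apply: (@Rintegral_dominated _ _ _ (fun v => poisson 1 v * C)).
  - by move=> n; exact: (L1_measurable (poisson_correlation_swap fL gL gi (e0 n)).2).
  - by apply: measurable_funM => //; exact: (L1_measurable (integral_poisson1).1).
  - move=> v; apply: cvgM; first exact: cvg_cst.
    rewrite /A; under [X in _ --> X]eq_Rintegral do rewrite addr0.
    apply: (correlation_cvg fL gL fr (B := `|v|)); last exact: harmonic_mul_cvg0.
    move=> n; rewrite normrM ger0_norm ?(ltW (e0 _))// ler_piMl//.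
    by rewrite invf_le1// ler1n.
  - by under eq_fun do rewrite mulrC; apply: L1Z; exact: (integral_poisson1).1.
  - move=> n v; rewrite normrM ger0_norm ?poisson_ge0// ler_wpM2l ?poisson_ge0//.
    have fgi : L1 (fun x => f x * g (x + e_ n * v)).
      by apply: L2_mul => //; exact: L2_shift.
    rewrite (le_trans (le_normr_Rintegral _ fgi))// -lee_fin RintegralE ?L1_norm//.
    exact: correlation_bound.
have lim1' : \int[mu]_v (poisson 1 v * A (e_ n * v)) @[n --> \oo] -->
    \int[mu]_w (costr f w * costr g w + sintr f w * sintr g w).
  by apply: cvg_trans lim1; apply: near_eq_cvg; apply: nearW => n /=; rewrite JE.
rewrite (cvg_unique (@Rhausdorff R) lim1' lim2) RintegralZr//; last exact: (integral_poisson1).1.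
rewrite (integral_poisson1).2 /A; congr (_ * _).
by apply: eq_Rintegral => x _; rewrite addr0.
Qed.

End parseval.

(** * Correlations as Fourier integrals *)
Section fourier.
Context {R : realType}.
Local Notation mu := (@lebesgue_measure R).
Local Notation L1 f := (mu.-integrable setT (EFin \o f)).

Definition cut (f : R -> R) (n : nat) : R -> R := f \_ `[- n%:R, n%:R].

Lemma cutE (f : R -> R) (n : nat) x : cut f n x = if `|x| <= n%:R then f x else 0.
Proof. by rewrite /cut patchE mem_setE in_itv/= -ler_norml. Qed.

Lemma L2_cut (f : R -> R) (n : nat) : L2 f -> L2 (cut f n).
Proof.
move=> fL; apply: (L2_le _ fL); last first.
  by move=> x; rewrite cutE; case: ifPn => // _; rewrite normr0.
apply/(measurable_restrictT f); first exact: measurable_itv.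
by apply: measurable_funTS; exact: L2_measurable.
Qed.

Lemma cut_support (f : R -> R) (n : nat) x : n%:R < `|x| -> cut f n x = 0.
Proof. by rewrite cutE ltNge => /negbTE ->. Qed.

Lemma L1_cut (f : R -> R) (n : nat) : L2 f -> L1 (cut f n).
Proof. by move=> fL; exact: (L2_L1_compact (L2_cut n fL) (@cut_support f n)). Qed.

Lemma fourier_truncE (f : R -> R) n w :
  fourier_trunc f n w = costr (cut f n) w -i* sintr (cut f n) w.
Proof.
rewrite /fourier_trunc /costr /sintr; congr (_ +i* - _);
  rewrite Rintegral_mkcond; apply: eq_Rintegral => x _;
  by rewrite cutE patchE mem_setE in_itv/= -ler_norml; case: ifPn; rewrite ?mul0r.
Qed.

(** The damping factor makes the kernel integrable on the plane, where Fubini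
    gives measurability of the sections' integrals; dividing by it afterwards
    keeps measurability. *)
Lemma measurable_kernel_transform (f : R -> R) (k : R * R -> R) : L1 f ->
  measurable_fun setT k -> (forall z, `|k z| <= 1) ->
  measurable_fun setT (fun w => \int[mu]_x (f x * k (w, x))).
Proof.
move=> fi mk k1; have mf := L1_measurable fi.
have ki w : L1 (fun x => f x * k (w, x)).
  under eq_fun do rewrite mulrC; apply: (@L1M_bounded _ _ _ 1) => //.
  exact: (measurableT_comp mk (pair1_measurable w)).
pose F (z : R * R) := damp 1 z.1 * (f z.2 * k (z.1, z.2)).
have mF : measurable_fun setT F.
  apply: measurable_funM; first exact: (measurableT_comp (measurable_damp 1) measurable_fst).
  apply: measurable_funM; first exact: (measurableT_comp mf measurable_snd).
  by apply: eq_measurable_fun mk => -[].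
have Gi : L1 (fun w => damp 1 w * \int[mu]_x `|f x|).
  by under eq_fun do rewrite mulrC; apply: L1Z; exact: damp_integrable.
have Fsb w : (\int[mu]_y `|F (w, y)|%:E <= (damp 1 w * \int[mu]_x `|f x|)%:E)%E.
  apply: (section_bound (k := fun y => damp 1 w * `|f y|)).
  - by apply: L1Z; exact: L1_norm.
  - exact: (measurableT_comp mF (pair1_measurable w)).
  - move=> y; rewrite normrM ger0_norm ?damp_ge0// ler_wpM2l ?damp_ge0//.
    by rewrite normrM ler_piMr.
  - by rewrite RintegralZl//; exact: L1_norm.
have := L1_measurable (Rintegral_section_L1 mF Gi Fsb).
have -> : (fun w => \int[mu]_y F (w, y)) =
    (fun w => damp 1 w * \int[mu]_x (f x * k (w, x))).
  by apply/funext => w; rewrite /F/= RintegralZl.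
move=> h; have : measurable_fun setT
    (fun w : R => expR `|w| * (damp 1 w * \int[mu]_x (f x * k (w, x)))).
  by apply: measurable_funM => //; apply: measurableT_comp.
apply: eq_measurable_fun => w _.
by rewrite /damp mul1r mulrA -expRD subrr expR0 mul1r.
Qed.

Lemma measurable_costr (f : R -> R) : L1 f -> measurable_fun setT (costr f).
Proof.
move=> fi; apply: (measurable_kernel_transform fi measurable_cosM) => z.
exact: cos_max.
Qed.

Lemma measurable_sintr (f : R -> R) : L1 f -> measurable_fun setT (sintr f).
Proof.
move=> fi; apply: (measurable_kernel_transform fi measurable_sinM) => z.
exact: sin_max.
Qed.

Lemma normc_sqr (z : R[i]) : ComplexField.Normc.normc z ^+ 2 =
  complex.Re z ^+ 2 + complex.Im z ^+ 2.
Proof.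
by case: z => a b; rewrite /ComplexField.Normc.normc/= sqr_sqrtr// addr_ge0 ?sqr_ge0.
Qed.

(** The squared modulus of the difference between F and the transform of the
    truncation of f to [-n, n]. *)
Definition trunc_error (f : R -> R) (F : R -> R[i]) (n : nat) (w : R) : R :=
  (complex.Re (F w) - costr (cut f n) w) ^+ 2 +
  (complex.Im (F w) + sintr (cut f n) w) ^+ 2.

(** The convergence of the L^2 norms of the errors makes them finite from some
    rank n0 on; the transforms of the truncations are then in L^2 as differences
    of L^2 functions. *)
Lemma is_fourier_trunc (f : R -> R) (F : R -> R[i]) : is_fourier f F ->
  exists n0, (forall n, L2 (costr (cut f (n + n0))) /\ L2 (sintr (cut f (n + n0))) /\
     L1 (trunc_error f F (n + n0))) /\
  \int[mu]_w trunc_error f F (n + n0) w @[n --> \oo] --> 0.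
Proof.
move=> [fL rL iL Fcvg].
have mcf n := measurable_costr (L1_cut n fL).
have msf n := measurable_sintr (L1_cut n fL).
pose N_ n := 'N[mu]_(2%:E)[EFin \o
         (fun w => ComplexField.Normc.normc (F w - fourier_trunc f n w)%R)]%E.
have NE n : (\int[mu]_w (trunc_error f F n w)%:E = N_ n `^ 2)%E.
  rewrite powR_Lnorm//; apply: eq_integral => w _.
  rewrite /= ger0_norm; last by case: (F w - _) => a b; rewrite sqrtr_ge0.
  rewrite powR_mulrn; last by case: (F w - _) => a b; rewrite sqrtr_ge0.
  rewrite normc_sqr fourier_truncE /trunc_error.
  by case: (F w) => a b; rewrite /= opprK.
have small e : 0 < e -> \forall n \near \oo,
    (\int[mu]_w (trunc_error f F n w)%:E <= (e ^+ 2)%:E)%E.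
  move=> e0.
  have /fine_cvgP[Nfin /cvgrPdist_lt/(_ e e0) Nc] := Fcvg.
  apply: filterS2 Nfin Nc => n nfin; rewrite sub0r normrN => nlt.
  rewrite NE -[N_ n](fineK nfin) poweR_EFin powR_mulrn ?fine_ge0 ?Lnorm_ge0// lee_fin.
  rewrite lerXn2r ?nnegrE ?fine_ge0 ?Lnorm_ge0 ?(ltW e0)//.
  by rewrite (le_trans (ler_norm _))// ltW.
have [n0 _ hn0] := small 1 ltr01.
have mE n : measurable_fun setT (trunc_error f F n).
  by apply: measurable_funD; apply: measurable_funX; [apply: measurable_funB|apply: measurable_funD] => //;
     exact: L2_measurable.
have E0 n w : 0 <= trunc_error f F n w by rewrite addr_ge0 ?sqr_ge0.
have iE n : (n0 <= n)%N -> L1 (trunc_error f F n).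
  move=> n0n; apply/integrableP; split; first by apply/measurable_EFinP; exact: mE.
  under eq_integral do rewrite /= ger0_norm//.
  by rewrite (le_lt_trans (hn0 n n0n))// ltry.
exists n0; split.
  move=> n; have ni := iE (n + n0)%N (leq_addl _ _).
  have rd : L2 (fun w => complex.Re (F w) - costr (cut f (n + n0)) w).
    apply/L2P; split; first by apply: measurable_funB => //; exact: L2_measurable.
    apply: (L1_le _ ni).
      by apply: measurable_funX; apply: measurable_funB => //; exact: L2_measurable.
    by move=> w; rewrite ger0_norm ?sqr_ge0// lerDl sqr_ge0.
  have imd : L2 (fun w => complex.Im (F w) + sintr (cut f (n + n0)) w).
    apply/L2P; split; first by apply: measurable_funD => //; exact: L2_measurable.
    apply: (L1_le _ ni).
      by apply: measurable_funX; apply: measurable_funD => //; exact: L2_measurable.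
    by move=> w; rewrite ger0_norm ?sqr_ge0// lerDr sqr_ge0.
  split; last split => //.
  - have := L2B rL rd; congr L2; apply/funext => w; ring.
  - have := L2B imd iL; congr L2; apply/funext => w; ring.
apply/cvgrPdist_le => e e0.
have se0 : 0 < Num.sqrt e by rewrite sqrtr_gt0.
have [n1 _ hn1] := small _ se0.
exists n1 => // n /= n1n; rewrite sub0r normrN ger0_norm; last first.
  by apply: Rintegral_ge0 => w _; exact: E0.
rewrite -lee_fin RintegralE; last by apply: iE; exact: leq_addl.
have := hn1 (n + n0)%N; rewrite /= sqr_sqrtr ?(ltW e0)//; apply.
by rewrite (leq_trans n1n)// leq_addr.
Qed.

Lemma L2_inner_cvg (a_ p_ : nat -> R -> R) (a p : R -> R) :
  (forall n, L2 (a_ n)) -> (forall n, L2 (p_ n)) -> L2 a -> L2 p ->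
  \int[mu]_w ((a w - a_ n w) ^+ 2) @[n --> \oo] --> 0 ->
  \int[mu]_w ((p w - p_ n w) ^+ 2) @[n --> \oo] --> 0 ->
  \int[mu]_w (a_ n w * p_ n w) @[n --> \oo] --> \int[mu]_w (a w * p w).
Proof.
move=> aL_ pL_ aL pL acvg pcvg.
pose s n := Num.sqrt (\int[mu]_w ((a w - a_ n w) ^+ 2)).
pose t n := Num.sqrt (\int[mu]_w ((p w - p_ n w) ^+ 2)).
pose A := Num.sqrt (\int[mu]_w (a w ^+ 2)).
pose P := Num.sqrt (\int[mu]_w (p w ^+ 2)).
have s0 : s n @[n --> \oo] --> 0.
  rewrite -[X in _ --> X](@sqrtr0 R).
  by apply: (@continuous_cvg _ _ _ _ _ _ Num.sqrt); [exact: sqrt_continuous|exact: acvg].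
have t0 : t n @[n --> \oo] --> 0.
  rewrite -[X in _ --> X](@sqrtr0 R).
  by apply: (@continuous_cvg _ _ _ _ _ _ Num.sqrt); [exact: sqrt_continuous|exact: pcvg].
have b0 : s n * t n + s n * P + A * t n @[n --> \oo] --> 0.
  have -> : 0 = 0 * 0 + 0 * P + A * 0 :> R by ring.
  by apply: cvgD; [apply: cvgD|]; apply: cvgM => //; exact: cvg_cst.
apply/cvgrPdist_le => e e0.
move/cvgrPdist_le/(_ _ e0): b0; apply: filterS => n.
rewrite sub0r normrN => /(le_trans (ler_norm _)); apply: le_trans.
have da := L2B aL (aL_ n); have dp := L2B pL (pL_ n).
have -> : \int[mu]_w (a w * p w) - \int[mu]_w (a_ n w * p_ n w) =
    \int[mu]_w ((a w - a_ n w) * p w) + \int[mu]_w (a w * (p w - p_ n w))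
    - \int[mu]_w ((a w - a_ n w) * (p w - p_ n w)).
  have i1 := L2_mul da pL; have i2 := L2_mul aL dp; have i3 := L2_mul da dp.
  rewrite -RintegralD; [|by []|exact: i1|exact: i2].
  rewrite -[RHS]RintegralB; [|by []|exact: (L1D i1 i2)|exact: i3].
  rewrite -[LHS]RintegralB; [|by []|exact: L2_mul|exact: L2_mul].
  by apply: eq_Rintegral => w _; ring.
rewrite (le_trans (ler_normB _ _))//.
have h1 : `|\int[mu]_w ((a w - a_ n w) * p w)| <= s n * P by exact: cauchy_schwarz.
have h2 : `|\int[mu]_w (a w * (p w - p_ n w))| <= A * t n by exact: cauchy_schwarz.
have h3 : `|\int[mu]_w ((a w - a_ n w) * (p w - p_ n w))| <= s n * t n.
  exact: cauchy_schwarz.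
have h4 := ler_normD (\int[mu]_w ((a w - a_ n w) * p w)) (\int[mu]_w (a w * (p w - p_ n w))).
rewrite [leRHS](_ : _ = s n * P + A * t n + s n * t n); last by ring.
by rewrite lerD// (le_trans h4)// lerD.
Qed.

Lemma costr_shift (g : R -> R) (tau w : R) : L1 g ->
  costr (fun y => g (y - tau)) w = costr g w * cos (tau * w) - sintr g w * sin (tau * w).
Proof.
move=> gi; rewrite /costr /sintr -!RintegralZr; [|by []|exact: L1_sin|by []|exact: L1_cos].
have i1 : L1 (fun x => g x * cos (w * x) * cos (tau * w)).
  by under [X in EFin \o X]eq_fun do rewrite mulrC; exact: (L1Z _ (L1_cos w gi)).
have i2 : L1 (fun x => g x * sin (w * x) * sin (tau * w)).
  by under [X in EFin \o X]eq_fun do rewrite mulrC; exact: (L1Z _ (L1_sin w gi)).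
rewrite -RintegralB; [|by []|exact: i1|exact: i2].
rewrite -(Rintegral_shift (- tau) (L1B i1 i2)); apply: eq_Rintegral => y _.
have -> : w * y = w * (y - tau) + tau * w by ring.
by rewrite cosD; ring.
Qed.

Lemma sintr_shift (g : R -> R) (tau w : R) : L1 g ->
  sintr (fun y => g (y - tau)) w = costr g w * sin (tau * w) + sintr g w * cos (tau * w).
Proof.
move=> gi; rewrite /costr /sintr -!RintegralZr; [|by []|exact: L1_sin|by []|exact: L1_cos].
have i1 : L1 (fun x => g x * cos (w * x) * sin (tau * w)).
  by under [X in EFin \o X]eq_fun do rewrite mulrC; exact: (L1Z _ (L1_cos w gi)).
have i2 : L1 (fun x => g x * sin (w * x) * cos (tau * w)).
  by under [X in EFin \o X]eq_fun do rewrite mulrC; exact: (L1Z _ (L1_sin w gi)).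
rewrite -RintegralD; [|by []|exact: i1|exact: i2].
rewrite -(Rintegral_shift (- tau) (L1D i1 i2)); apply: eq_Rintegral => y _.
have -> : w * y = w * (y - tau) + tau * w by ring.
by rewrite sinD; ring.
Qed.

Lemma L2_rotate (c d : R -> R) (tau : R) : L2 c -> L2 d ->
  L2 (fun w => c w * cos (tau * w) + d w * sin (tau * w)).
Proof.
move=> cL dL; apply: L2D.
  apply: (L2_le _ cL).
    apply: measurable_funM; first exact: L2_measurable.
    exact: (measurableT_comp measurable_cosM (pair1_measurable tau)).
  by move=> w; rewrite normrM ler_piMr//; exact: cos_max.
apply: (L2_le _ dL).
  apply: measurable_funM; first exact: L2_measurable.
  exact: (measurableT_comp measurable_sinM (pair1_measurable tau)).
by move=> w; rewrite normrM ler_piMr//; exact: sin_max.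
Qed.

Lemma rotate_sqr_le (x y t : R) : (x * cos t + y * sin t) ^+ 2 <= x ^+ 2 + y ^+ 2.
Proof.
have := cos2Dsin2 t => h.
have -> : x ^+ 2 + y ^+ 2 = (x ^+ 2 + y ^+ 2) * (cos t ^+ 2 + sin t ^+ 2) by rewrite h mulr1.
rewrite -subr_ge0.
have -> : (x ^+ 2 + y ^+ 2) * (cos t ^+ 2 + sin t ^+ 2) - (x * cos t + y * sin t) ^+ 2 =
  (x * sin t - y * cos t) ^+ 2 by ring.
exact: sqr_ge0.
Qed.

Lemma sqr_error_cvg0 (h_ E_ : nat -> R -> R) :
  (forall n, measurable_fun setT (h_ n)) -> (forall n, L1 (E_ n)) ->
  (forall n w, (h_ n w) ^+ 2 <= E_ n w) ->
  \int[mu]_w E_ n w @[n --> \oo] --> 0 ->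
  \int[mu]_w (h_ n w ^+ 2) @[n --> \oo] --> 0.
Proof.
move=> mh Ei hE Ecvg; apply: (squeeze_cvgr _ _ Ecvg); last exact: cvg_cst.
apply: nearW => n; apply/andP; split; first by apply: Rintegral_ge0 => w _; exact: sqr_ge0.
apply: le_Rintegral => //; apply: (L1_le _ (Ei n)); first exact: measurable_funX.
by move=> w; rewrite ger0_norm ?sqr_ge0.
Qed.

(** The real part of F(w) conj(G(w)) exp(i tau w). *)
Definition cross_spectrum (F G : R -> R[i]) (tau w : R) : R :=
  complex.Re (F w) * (complex.Re (G w) * cos (tau * w) + complex.Im (G w) * sin (tau * w)) +
  complex.Im (F w) * (complex.Im (G w) * cos (tau * w) - complex.Re (G w) * sin (tau * w)).

(** Apply [parseval_compact] to the truncations of f and of the translate of g,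
    whose transforms converge in L^2; the correlations of the truncations converge
    by domination. The truncation of g is translated by tau, so that its
    transform is a rotation of that of the truncation itself. *)
Lemma crosscorr_parseval (f g : R -> R) (F G : R -> R[i]) (tau : R) :
  is_fourier f F -> is_fourier g G ->
  2 * pi * crosscorr f g tau = \int[mu]_w cross_spectrum F G tau w.
Proof.
move=> fF gG.
have [n1 [f1 f2]] := is_fourier_trunc fF.
have [n2 [g1 g2]] := is_fourier_trunc gG.
have [fL rF iF _] := fF; have [gL rG iG _] := gG.
(* F = a - i b, and p - i q is the transform of g (x - tau) *)
pose a w := complex.Re (F w); pose b w := - complex.Im (F w).
pose p w := complex.Re (G w) * cos (tau * w) + complex.Im (G w) * sin (tau * w).
pose q w := complex.Re (G w) * sin (tau * w) - complex.Im (G w) * cos (tau * w).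
have aL : L2 a by exact: rF.
have bL : L2 b by have := L2Z (-1) iF; congr L2; apply/funext => w; rewrite mulN1r.
have pL : L2 p by exact: L2_rotate.
have iGN : L2 (fun w => - complex.Im (G w)).
  by have := L2Z (-1) iG; congr L2; apply/funext => w; rewrite mulN1r.
have qL : L2 q.
  by have := L2_rotate tau iGN rG; congr L2; apply/funext => w; rewrite /q; ring.
pose fs n := cut f (n + n1); pose gs n y := cut g (n + n2) (y - tau).
have fsL n : L2 (fs n) by exact: L2_cut.
have gsL n : L2 (gs n) by apply: (L2_shift (- tau)); exact: L2_cut.
have gsi n : L1 (gs n) by apply: (L1_shift (- tau)); exact: L1_cut.
have pE n w : costr (gs n) w = costr (cut g (n + n2)) w * cos (tau * w) -
    sintr (cut g (n + n2)) w * sin (tau * w) by exact: (costr_shift tau w (L1_cut _ gL)).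
have qE n w : sintr (gs n) w = costr (cut g (n + n2)) w * sin (tau * w) +
    sintr (cut g (n + n2)) w * cos (tau * w) by exact: (sintr_shift tau w (L1_cut _ gL)).
have aL_ n : L2 (costr (fs n)) by case: (f1 n).
have bL_ n : L2 (sintr (fs n)) by case: (f1 n) => _ [].
have pL_ n : L2 (costr (gs n)).
  have [cL [sL _]] := g1 n.
  have := L2_rotate tau cL (L2Z (-1) sL); congr L2; apply/funext => w.
  by rewrite pE; ring.
have qL_ n : L2 (sintr (gs n)).
  have [cL [sL _]] := g1 n.
  have := L2_rotate tau sL cL; congr L2; apply/funext => w.
  by rewrite qE; ring.
have Ef n : L1 (trunc_error f F (n + n1)) by case: (f1 n) => _ [].
have Eg n : L1 (trunc_error g G (n + n2)) by case: (g1 n) => _ [].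
have acvg : \int[mu]_w ((a w - costr (fs n) w) ^+ 2) @[n --> \oo] --> 0.
  apply: (sqr_error_cvg0 _ Ef _ f2) => [n|n w].
    by apply: L2_measurable; exact: L2B.
  by rewrite lerDl sqr_ge0.
have bcvg : \int[mu]_w ((b w - sintr (fs n) w) ^+ 2) @[n --> \oo] --> 0.
  apply: (sqr_error_cvg0 _ Ef _ f2) => [n|n w].
    by apply: L2_measurable; exact: L2B.
  by rewrite /b -opprD sqrrN lerDr sqr_ge0.
have pcvg : \int[mu]_w ((p w - costr (gs n) w) ^+ 2) @[n --> \oo] --> 0.
  apply: (sqr_error_cvg0 _ Eg _ g2) => [n|n w].
    by apply: L2_measurable; exact: L2B.
  apply: le_trans (rotate_sqr_le _ _ (tau * w)).
  by rewrite pE /p le_eqVlt; apply/orP; left; apply/eqP; congr (_ ^+ 2); ring.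
have qcvg : \int[mu]_w ((q w - sintr (gs n) w) ^+ 2) @[n --> \oo] --> 0.
  apply: (sqr_error_cvg0 _ Eg _ g2) => [n|n w].
    by apply: L2_measurable; exact: L2B.
  have := rotate_sqr_le (- (complex.Im (G w) + sintr (cut g (n + n2)) w))
    (complex.Re (G w) - costr (cut g (n + n2)) w) (tau * w).
  rewrite sqrrN [leRHS]addrC; apply: le_trans.
  by rewrite qE /q le_eqVlt; apply/orP; left; apply/eqP; congr (_ ^+ 2); ring.
have lim1 : \int[mu]_w (costr (fs n) w * costr (gs n) w) +
    \int[mu]_w (sintr (fs n) w * sintr (gs n) w) @[n --> \oo] -->
    \int[mu]_w (a w * p w) + \int[mu]_w (b w * q w).
  by apply: cvgD; [exact: L2_inner_cvg acvg pcvg|exact: L2_inner_cvg bcvg qcvg].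
have -> : \int[mu]_w cross_spectrum F G tau w =
    \int[mu]_w (a w * p w) + \int[mu]_w (b w * q w).
  rewrite -RintegralD; [|by []|exact: L2_mul|exact: L2_mul].
  by apply: eq_Rintegral => w _; rewrite /cross_spectrum /a /b /p /q; ring.
have P n : \int[mu]_w (costr (fs n) w * costr (gs n) w) +
    \int[mu]_w (sintr (fs n) w * sintr (gs n) w) = 2 * pi * \int[mu]_x (fs n x * gs n x).
  rewrite -(parseval_compact (fsL n) (gsL n) (@cut_support f (n + n1)) (gsi n) (aL_ n) (bL_ n) (pL_ n) (qL_ n)).
  by rewrite -RintegralD; [by []|by []|exact: L2_mul|exact: L2_mul].
have lim2 : 2 * pi * \int[mu]_x (fs n x * gs n x) @[n --> \oo] -->
    2 * pi * crosscorr f g tau.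
  apply: cvgM; first exact: cvg_cst.
  have fgi : L1 (fun x => f x * g (x - tau)).
    by apply: L2_mul => //; exact: (L2_shift (- tau)).
  apply: (@Rintegral_dominated _ _ _ (fun x => `|f x * g (x - tau)|)).
  - by move=> n; apply: measurable_funM; exact: L2_measurable.
  - exact: L1_measurable.
  - move=> x; apply: cvg_near_cst; near=> n; rewrite /fs /gs !cutE !ifT//.
    + rewrite (@le_trans _ _ n%:R)//; last by rewrite ler_nat leq_addr.
      near: n; exact: nbhs_infty_ger.
    + rewrite (@le_trans _ _ n%:R)//; last by rewrite ler_nat leq_addr.
      near: n; exact: nbhs_infty_ger.
  - exact: L1_norm.
  - move=> n x; rewrite /fs /gs !cutE; case: ifPn => _; last by rewrite mul0r normr0.
    by case: ifPn => _ //; rewrite mulr0 normr0.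
have lim1' : 2 * pi * \int[mu]_x (fs n x * gs n x) @[n --> \oo] -->
    \int[mu]_w (a w * p w) + \int[mu]_w (b w * q w).
  by apply: cvg_trans lim1; apply: near_eq_cvg; apply: nearW => n /=; rewrite -P.
exact: (cvg_unique (@Rhausdorff R) lim2 lim1').
Unshelve. all: by end_near. Qed.

End fourier.

(** * Decay of Fourier integrals with a piecewise constant factor *)
Section decay.
Context {R : realType}.
Local Notation mu := (@lebesgue_measure R).
Local Notation L1 f := (mu.-integrable setT (EFin \o f)).

Lemma le_abs_Rintegral_itv (f g : R -> R) (a b : R) :
  mu.-integrable `[a, b] (EFin \o f) -> mu.-integrable `[a, b] (EFin \o g) ->
  (forall x, x \in `[a, b] -> `|f x| <= g x) ->
  `|\int[mu]_(x in `[a, b]) f x| <= \int[mu]_(x in `[a, b]) g x.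
Proof.
move=> fi gi fg; rewrite (le_trans (le_normr_Rintegral _ fi))//.
apply: le_Rintegral => //; exact: (integrable_norm fi).
Qed.

Lemma continuous_cos_affineM (h : R -> R) (s t : R) : continuous h ->
  continuous (fun w => h w * cos (s * w + t)).
Proof. by move=> ch w; apply: cvgM; [exact: ch|exact: continuous_cos_affine]. Qed.

Lemma continuous_sin_affineM (h : R -> R) (s t : R) : continuous h ->
  continuous (fun w => h w * sin (s * w + t)).
Proof. by move=> ch w; apply: cvgM; [exact: ch|exact: continuous_sin_affine]. Qed.

(** The value at x0 differs from the value at any x of the segment by at most the
    total variation; average this bound over x. *)
Lemma pointwise_le_Rintegral (h h' : R -> R) (a b x0 : R) : a < b ->
  (forall x : R, is_derive x 1 h (h' x)) -> continuous h' -> x0 \in `[a, b] ->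
  `|h x0| <= (b - a)^-1 * \int[mu]_(x in `[a, b]) `|h x| + \int[mu]_(x in `[a, b]) `|h' x|.
Proof.
move=> ab dh ch' x0ab; have ch := is_derive_continuous dh.
set V := \int[mu]_(x in `[a, b]) `|h' x|.
have ba : 0 < b - a by rewrite subr_gt0.
have cn (f : R -> R) : continuous f -> continuous (fun x => `|f x|).
  by move=> cf x; apply: cvg_norm; exact: cf.
have var x y : a <= x -> x <= y -> y <= b -> `|h y - h x| <= V.
  move=> ax xy yb; rewrite -(Rintegral_FTC xy dh ch').
  apply: (@le_trans _ _ (\int[mu]_(x in `[x, y]) `|h' x|)).
    by apply: le_abs_Rintegral_itv => //; apply: integrable_itv => //; exact: cn.
  rewrite /V (@Rintegral_itv_cat _ _ a b x) ?(le_trans xy)//; last by apply: integrable_itv; exact: cn.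
  rewrite (@Rintegral_itv_cat _ _ x b y)//; last by apply: integrable_itv; exact: cn.
  have I0 c d : 0 <= \int[mu]_(x in `[c, d]) `|h' x| by apply: Rintegral_ge0.
  by rewrite addrCA lerDl addr_ge0.
have le1 x : x \in `[a, b] -> `|h x0| <= `|h x| + V.
  move: x0ab; rewrite !in_itv/= => /andP[ax0 x0b] /andP[ax xb].
  rewrite -lerBlDl (le_trans (lerB_dist _ _))//.
  by have [xx|/ltW xx] := leP x x0; [|rewrite distrC]; exact: var.
have Vi : \int[mu]_(x in `[a, b]) cst `|h x0| x = (b - a) * `|h x0|.
  by rewrite Rintegral_cst//= lebesgue_measure_itv/= lte_fin ab -EFinD/= mulrC.
have Vi' : \int[mu]_(x in `[a, b]) cst V x = (b - a) * V.
  by rewrite Rintegral_cst//= lebesgue_measure_itv/= lte_fin ab -EFinD/= mulrC.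
have : (b - a) * `|h x0| <= \int[mu]_(x in `[a, b]) `|h x| + (b - a) * V.
  have cc (c : R) : mu.-integrable `[a, b] (EFin \o cst c).
    by apply: integrable_itv; exact: cst_continuous.
  have hi : mu.-integrable `[a, b] (EFin \o (fun x => `|h x|)).
    by apply: integrable_itv; exact: cn.
  rewrite -Vi -Vi' -RintegralD; [|by []|exact: hi|exact: cc].
  apply: le_Rintegral => //.
  by have := integrableD _ hi (cc V); apply.
by rewrite -ler_pdivlMl// mulrDr mulKf// gt_eqF.
Qed.

Section step.
Variables (p : R) (p0 : 0 < p) (eps : int -> R).
Hypothesis eps1 : forall k, `|eps k| <= 1.

(** The function equal to [eps k] on the cell [p k, p (k + 1)). *)
Definition step (w : R) : R := eps (Num.floor (w / p)).

Let cell (k : int) : set R := `[p * k%:~R, p * (k + 1)%:~R]%classic.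

Lemma stepE (k : int) w : p * k%:~R <= w < p * (k + 1)%:~R -> step w = eps k.
Proof.
move=> kw; rewrite /step (@floor_def _ _ k)//.
by rewrite ler_pdivlMr// ltr_pdivrMr// ![_ * p]mulrC.
Qed.

Lemma measurable_step : measurable_fun setT step.
Proof.
move=> _ Y mY; rewrite setTI.
have -> : step @^-1` Y = \bigcup_(k in [set: int])
    (`[p * k%:~R, p * (k + 1)%:~R[%classic `&` [set _ | Y (eps k)]).
  apply/seteqP; split => w.
    move=> Yw; exists (Num.floor (w / p)) => //; split => //.
    by rewrite /= in_itv/= ![p * _]mulrC -ler_pdivlMr// -ltr_pdivrMr// floor_itv.
  by move=> [k _ []]; rewrite /= in_itv/= => /stepE ->.
apply: countable_bigcupT_measurable; first exact: countableP.
move=> k; have [Yk|Yk] := pselect (Y (eps k)).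
  have -> : [set _ : R | Y (eps k)] = setT by apply/seteqP; split.
  by rewrite setIT; exact: measurable_itv.
have -> : [set _ : R | Y (eps k)] = set0 by apply/seteqP; split.
by rewrite setI0.
Qed.

Lemma step_le1 w : `|step w| <= 1. Proof. exact: eps1. Qed.

Lemma L1_step (h : R -> R) : L1 h -> L1 (fun w => step w * h w).
Proof. by move=> hi; exact: (L1M_bounded measurable_step step_le1 hi). Qed.

(** The value of the step function at the right end of the cell belongs to the
    next cell; the endpoint has measure 0. *)
Lemma Rintegral_step_cell (h : R -> R) (k : int) : continuous h ->
  \int[mu]_(w in cell k) (step w * h w) = eps k * \int[mu]_(w in cell k) h w.
Proof.
move=> ch.
have hi : mu.-integrable (cell k) (EFin \o h) by exact: integrable_itv.
have ehi : mu.-integrable (cell k) (EFin \o (fun w => eps k * h w)).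
  apply: integrable_itv => w; apply: cvgM; [exact: cvg_cst|exact: ch].
rewrite -RintegralZl//; last exact: measurable_itv.
rewrite /Rintegral; congr fine; rewrite /cell.
rewrite -!integral_itv_bndo_bndc//; last 2 first.
- apply/measurable_EFinP; apply: measurable_funM => //.
  by apply: measurable_funTS; exact: continuous_measurable_fun.
- apply/measurable_EFinP; apply: measurable_funM; first exact: measurable_funTS measurable_step.
  by apply: measurable_funTS; exact: continuous_measurable_fun.
by apply: eq_integral => w; rewrite inE/= in_itv/= => /stepE ->.
Qed.

Lemma le_cells (k : int) : p * k%:~R <= p * (k + 1)%:~R.
Proof. by rewrite ler_pM2l// ler_int lerDl. Qed.

Lemma integrable_step_itv (h : R -> R) a b : continuous h ->
  mu.-integrable `[a, b] (EFin \o (fun w => step w * h w)).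
Proof.
move=> ch; have hi := integrable_itv a b ch.
apply: (le_integrable _ _ _ hi) => //.
  apply/measurable_EFinP; apply: measurable_funM; first exact: measurable_funTS measurable_step.
  by apply: measurable_funTS; exact: continuous_measurable_fun.
by move=> x _ /=; rewrite lee_fin normrM ler_piMl// step_le1.
Qed.

Lemma Rintegral_cells (f : R -> R) (n : nat) :
  (forall a b, mu.-integrable `[a, b] (EFin \o f)) ->
  \int[mu]_(w in `[- (p * n%:R), p * n%:R]) f w =
  \sum_(0 <= i < n + n) \int[mu]_(w in cell (- n%:Z + i%:Z)) f w.
Proof.
move=> fi.
have H (a : int) (m : nat) : \int[mu]_(w in `[p * a%:~R, p * (a + m%:Z)%:~R]) f w =
    \sum_(0 <= i < m) \int[mu]_(w in cell (a + i%:Z)) f w.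
  elim: m => [|m IH]; first by rewrite addr0 set_itv1 Rintegral_set1 big_geq.
  rewrite big_nat_recr//= -IH.
  have -> : a + m.+1%:Z = a + m%:Z + 1 by rewrite intS; ring.
  rewrite (@Rintegral_itv_cat _ _ _ _ (p * (a + m%:Z)%:~R))//.
  - by rewrite ler_pM2l// ler_int lerDl.
  - exact: le_cells.
rewrite -H; congr (Rintegral mu [set` _] _).
have -> : - n%:Z + (n + n)%N%:Z = n%:Z by rewrite PoszD; ring.
by rewrite mulrNz mulrN -!pmulrn.
Qed.

Lemma Rintegral_step_cells (h : R -> R) (n : nat) : continuous h ->
  \int[mu]_(w in `[- (p * n%:R), p * n%:R]) (step w * h w) =
  \sum_(0 <= i < n + n) eps (- n%:Z + i%:Z) * \int[mu]_(w in cell (- n%:Z + i%:Z)) h w.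
Proof.
move=> ch; rewrite Rintegral_cells; last by move=> a b; exact: integrable_step_itv.
by apply: eq_bigr => i _; exact: Rintegral_step_cell.
Qed.

Section parts.
Variables (h h' : R -> R) (s t : R).
Hypotheses (dh : forall x : R, is_derive x 1 h (h' x)) (ch' : continuous h').
Let ch : continuous h := is_derive_continuous dh.

Lemma cell_parts (k : int) :
  s * \int[mu]_(w in cell k) (h w * cos (s * w + t)) =
  h (p * (k + 1)%:~R) * sin (s * (p * (k + 1)%:~R) + t)
  - h (p * k%:~R) * sin (s * (p * k%:~R) + t)
  - \int[mu]_(w in cell k) (h' w * sin (s * w + t)).
Proof.
have ccos := @continuous_cos_affine R s t.
have cG : continuous (fun w : R => cos (s * w + t) * s).
  by move=> w; apply: cvgM; [exact: ccos|exact: cvg_cst].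
have := Rintegral_parts (le_cells k) dh ch' (is_derive_sin_affine s t) cG.
move=> <-; rewrite -RintegralZl.
- by apply: eq_Rintegral => w _; ring.
- exact: measurable_itv.
- by apply: integrable_itv; exact: continuous_cos_affineM.
Qed.

Hypotheses (hi : L1 h) (hi' : L1 h').

(** The value of h at p n is at most the integral of phi = |h| / p + |h'| over
    the neighbouring cell ([pointwise_le_Rintegral]); these integrals are
    differences of consecutive terms of a convergent sequence. *)
Lemma boundary_cvg0 :
  (`|h (p * n%:R)| + `|h (- (p * n%:R))|) @[n --> \oo] --> (0 : R).
Proof.
pose phi x := p^-1 * `|h x| + `|h' x|.
have cphi : continuous phi.
  move=> x; apply: cvgD; first by apply: cvgM; [exact: cvg_cst|apply: cvg_norm; exact: ch].
  by apply: cvg_norm; exact: ch'.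
have phii : L1 phi by apply: L1D; [apply: L1Z|]; exact: L1_norm.
pose g n := \int[mu]_(x in `[- (p * n%:R), p * n%:R]) phi x.
have gc : g n @[n --> \oo] --> \int[mu]_x phi x by exact: cvg_Rintegral_itv.
have gd : (g n.+1 - g n) @[n --> \oo] --> (0 : R).
  rewrite -[X in _ --> X](subrr (\int[mu]_x phi x)); apply: cvgB => //.
  by rewrite (cvg_shiftS g).
have pn n : p * n%:R <= p * n.+1%:R by rewrite ler_pM2l// ler_nat.
have pn0 n : 0 <= p * n%:R by rewrite mulr_ge0// ltW.
have pt a x0 : x0 \in `[a, a + p] -> `|h x0| <= \int[mu]_(x in `[a, a + p]) phi x.
  move=> x0a; have apa : a < a + p by rewrite ltrDl.
  have := pointwise_le_Rintegral apa dh ch' x0a; rewrite addrAC subrr add0r.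
  have c1 : continuous (fun x => `|h x|) by move=> x; apply: cvg_norm; exact: ch.
  have c2 : continuous (fun x => `|h' x|) by move=> x; apply: cvg_norm; exact: ch'.
  rewrite -RintegralZl; [|exact: measurable_itv|exact: integrable_itv].
  rewrite -RintegralD; [by []|exact: measurable_itv| |exact: integrable_itv].
  by apply: integrable_itv => x; apply: cvgM; [exact: cvg_cst|exact: c1].
apply: (squeeze_cvgr _ (cvg_cst 0) gd).
apply: nearW => n; rewrite addr_ge0//=.
have E : g n.+1 - g n = \int[mu]_(x in `[- (p * n.+1%:R), - (p * n%:R)]) phi x +
    \int[mu]_(x in `[p * n%:R, p * n.+1%:R]) phi x.
  rewrite /g (@Rintegral_itv_cat _ phi (- (p * n.+1%:R)) _ (- (p * n%:R))).
  - rewrite (@Rintegral_itv_cat _ phi (- (p * n%:R)) _ (p * n%:R)).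
    + by rewrite addrCA addrAC subrr add0r.
    + by rewrite (le_trans _ (pn0 n))// oppr_le0.
    + exact: pn.
    + exact: integrable_itv.
  - by rewrite lerN2.
  - by rewrite (le_trans _ (pn0 _))// oppr_le0.
  - exact: integrable_itv.
rewrite E addrC; apply: lerD.
  have -> : - (p * n%:R) = - (p * n.+1%:R) + p by rewrite -natr1; ring.
  by apply: pt; rewrite in_itv/= lerDl (ltW p0) lexx.
have -> : p * n.+1%:R = p * n%:R + p by rewrite -natr1; ring.
by apply: pt; rewrite in_itv/= lexx lerDl (ltW p0).
Qed.

(** Summing [cell_parts] over the cells of [- p n, p n], the hypothesis on the
    jumps makes the boundary terms telescope, and the two remaining ones tend to
    0 by [boundary_cvg0]. *)
Lemma step_parts :
  (forall k, eps k * h (p * (k + 1)%:~R) = eps (k + 1) * h (p * (k + 1)%:~R)) ->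
  s * \int[mu]_w (step w * (h w * cos (s * w + t))) =
  - \int[mu]_w (step w * (h' w * sin (s * w + t))).
Proof.
move=> jump.
have mcos : measurable_fun setT (fun w : R => cos (s * w + t)).
  by apply: continuous_measurable_fun; exact: continuous_cos_affine.
have msin : measurable_fun setT (fun w : R => sin (s * w + t)).
  by apply: continuous_measurable_fun; exact: continuous_sin_affine.
have i1 : L1 (fun w => h w * cos (s * w + t)).
  under [X in EFin \o X]eq_fun do rewrite mulrC.
  by apply: (@L1M_bounded _ _ _ 1) => // w; exact: cos_max.
have i2 : L1 (fun w => h' w * sin (s * w + t)).
  under [X in EFin \o X]eq_fun do rewrite mulrC.
  by apply: (@L1M_bounded _ _ _ 1) => // w; exact: sin_max.
have l1 := cvg_Rintegral_itv p0 (L1_step i1).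
have l2 := cvg_Rintegral_itv p0 (L1_step i2).
pose c (k : int) := eps k * (h (p * k%:~R) * sin (s * (p * k%:~R) + t)).
have E n : s * \int[mu]_(x in `[- (p * n%:R), p * n%:R]) (step x * (h x * cos (s * x + t))) +
    \int[mu]_(x in `[- (p * n%:R), p * n%:R]) (step x * (h' x * sin (s * x + t))) =
    c n%:Z - c (- n%:Z).
  rewrite !Rintegral_step_cells; last 2 first.
  - exact: continuous_sin_affineM.
  - exact: continuous_cos_affineM.
  rewrite mulr_sumr -big_split/=.
  rewrite (telescope_sumr_eq (fun i => c (- n%:Z + i%:Z)))//.
    have -> : - n%:Z + (n + n)%N%:Z = n%:Z by rewrite PoszD; ring.
    by rewrite addr0.
  move=> i _; rewrite mulrCA cell_parts.
  have -> : - n%:Z + i.+1%:Z = - n%:Z + i%:Z + 1 by rewrite intS; ring.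
  set k := - n%:Z + i%:Z.
  have -> : c (k + 1) = eps k * (h (p * (k + 1)%:~R) * sin (s * (p * (k + 1)%:~R) + t)).
    by rewrite /c mulrA -jump -mulrA.
  by rewrite /c; ring.
have l3 : c n%:Z - c (- n%:Z) @[n --> \oo] --> (0 : R).
  apply/norm_cvg0P; apply: (squeeze_cvgr _ (cvg_cst 0) boundary_cvg0).
  apply: nearW => n; rewrite normr_ge0/= (le_trans (ler_normB _ _))// lerD//.
    rewrite /c !normrM -[leRHS]mul1r ler_pM ?mulr_ge0//.
    by rewrite -pmulrn ler_piMr//; exact: sin_max.
  rewrite /c !normrM -[leRHS]mul1r ler_pM ?mulr_ge0//.
  by rewrite mulrNz mulrN -pmulrn ler_piMr//; exact: sin_max.
have l4 : s * \int[mu]_(x in `[- (p * n%:R), p * n%:R]) (step x * (h x * cos (s * x + t))) +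
    \int[mu]_(x in `[- (p * n%:R), p * n%:R]) (step x * (h' x * sin (s * x + t)))
  @[n --> \oo] --> s * \int[mu]_w (step w * (h w * cos (s * w + t))) +
    \int[mu]_w (step w * (h' w * sin (s * w + t))).
  by apply: cvgD => //; apply: cvgM => //; exact: cvg_cst.
have l4' : c n%:Z - c (- n%:Z) @[n --> \oo] -->
  s * \int[mu]_w (step w * (h w * cos (s * w + t))) +
    \int[mu]_w (step w * (h' w * sin (s * w + t))).
  by apply: cvg_trans l4; apply: near_eq_cvg; apply: nearW => n /=; rewrite E.
by apply/eqP; rewrite -addr_eq0; apply/eqP; exact: (cvg_unique (@Rhausdorff R) l4' l3).
Qed.

(** Without any hypothesis on the jumps, the two boundary terms of each cell are
    bounded by [pointwise_le_Rintegral]; each contributes |h| / p + |h'|, and the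
    integral that remains contributes |h'|. *)
Lemma step_last_bound :
  `|s * \int[mu]_w (step w * (h w * cos (s * w + t)))| <=
  \int[mu]_w (2 / p * `|h w| + 3 * `|h' w|).
Proof.
have mcos : measurable_fun setT (fun w : R => cos (s * w + t)).
  by apply: continuous_measurable_fun; exact: continuous_cos_affine.
have i1 : L1 (fun w => h w * cos (s * w + t)).
  under [X in EFin \o X]eq_fun do rewrite mulrC.
  by apply: (@L1M_bounded _ _ _ 1) => // w; exact: cos_max.
have l1 := cvg_Rintegral_itv p0 (L1_step i1).
pose psi w := 2 / p * `|h w| + 3 * `|h' w|.
have cah : continuous (fun x => `|h x|) by move=> x; apply: cvg_norm; exact: ch.
have cah' : continuous (fun x => `|h' x|) by move=> x; apply: cvg_norm; exact: ch'.
have c2h : continuous (fun x => 2 / p * `|h x|).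
  by move=> w; apply: cvgM; [exact: cvg_cst|exact: cah].
have c3h : continuous (fun x => 3 * `|h' x|).
  by move=> w; apply: cvgM; [exact: cvg_cst|exact: cah'].
have cpsi : continuous psi by move=> w; apply: cvgD; [exact: c2h|exact: c3h].
have psii : L1 psi by apply: L1D; apply: L1Z; exact: L1_norm.
have psi0 w : 0 <= psi w.
  by rewrite /psi addr_ge0// mulr_ge0// divr_ge0// ltW.
have cellb k : `|s * \int[mu]_(w in cell k) (h w * cos (s * w + t))| <=
    \int[mu]_(w in cell k) psi w.
  rewrite cell_parts.
  have kk : p * k%:~R < p * (k + 1)%:~R by rewrite ltr_pM2l// ltr_int ltrDl.
  have kp : p * (k + 1)%:~R - p * k%:~R = p by rewrite intrD; ring.
  have bpt x0 := pointwise_le_Rintegral (x0 := x0) kk dh ch'.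
  rewrite kp in bpt.
  have b1 : `|h (p * (k + 1)%:~R)| <= p^-1 * \int[mu]_(x in cell k) `|h x| +
      \int[mu]_(x in cell k) `|h' x|.
    by apply: bpt; rewrite in_itv/= lexx ltW.
  have b2 : `|h (p * k%:~R)| <= p^-1 * \int[mu]_(x in cell k) `|h x| +
      \int[mu]_(x in cell k) `|h' x|.
    by apply: bpt; rewrite in_itv/= lexx ltW.
  have b3 : `|\int[mu]_(w in cell k) (h' w * sin (s * w + t))| <=
      \int[mu]_(x in cell k) `|h' x|.
    apply: le_abs_Rintegral_itv.
    - by apply: integrable_itv; exact: continuous_sin_affineM.
    - exact: integrable_itv.
    - by move=> x _; rewrite normrM ler_piMr//; exact: sin_max.
  have s1 : `|h (p * (k + 1)%:~R) * sin (s * (p * (k + 1)%:~R) + t)| <= `|h (p * (k + 1)%:~R)|.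
    by rewrite normrM ler_piMr//; exact: sin_max.
  have s2 : `|h (p * k%:~R) * sin (s * (p * k%:~R) + t)| <= `|h (p * k%:~R)|.
    by rewrite normrM ler_piMr//; exact: sin_max.
  rewrite RintegralD; [|exact: measurable_itv|exact: integrable_itv|exact: integrable_itv].
  rewrite !RintegralZl; [|exact: measurable_itv|exact: integrable_itv|exact: measurable_itv|exact: integrable_itv].
  rewrite (le_trans (ler_normB _ _))//.
  apply: le_trans (lerD (le_trans (ler_normB _ _)
    (lerD (le_trans s1 b1) (le_trans s2 b2))) b3) _.
  by rewrite le_eqVlt; apply/orP; left; apply/eqP; ring.
apply: (@closed_cvg _ _ _ eventually_filter
  (fun n => `|s * \int[mu]_(x in `[- (p * n%:R), p * n%:R]) (step x * (h x * cos (s * x + t)))|)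
  [set y | y <= \int[mu]_w psi w]).
- exact: closed_le.
- apply: nearW => n /=.
  apply: (@le_trans _ _ (\int[mu]_(x in `[- (p * n%:R), p * n%:R]) psi x)); last first.
    rewrite Rintegral_mkcond; apply: le_Rintegral => //.
    + by apply: integrable_patch; [exact: measurable_itv|exact: integrable_itv].
    + by move=> w _; rewrite patchE; case: ifPn.
  rewrite Rintegral_step_cells; last exact: continuous_cos_affineM.
  rewrite Rintegral_cells; last by move=> a b; exact: integrable_itv.
  rewrite mulr_sumr (le_trans (ler_norm_sum _ _ _))//.
  apply: ler_sum => i _; rewrite mulrCA normrM.
  by rewrite -[leRHS]mul1r ler_pM.
- apply: cvg_norm; apply: cvgM; [exact: cvg_cst|exact: l1].
Qed.

End parts.
End step.

Lemma Ck_is_derive (n q : nat) (S : R -> R) : Ck n S -> (q < n)%N ->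
  forall x : R, is_derive x 1 (derive1n q S) (derive1n q.+1 S x).
Proof.
move=> [dS _] qn x; rewrite derive1nS derive1E.
by apply: DeriveDef => //; exact: dS.
Qed.

Lemma Ck_continuous (n q : nat) (S : R -> R) : Ck n S -> (q <= n)%N ->
  continuous (derive1n q S).
Proof.
move=> CS; rewrite leq_eqVlt => /predU1P[->|qn]; first by case: CS.
exact: (is_derive_continuous (Ck_is_derive CS qn)).
Qed.

(** m integrations by parts with cancelling boundary terms, each of which turns
    cos(s w + t) into - sin(s w + t) = cos(s w + t + pi / 2), followed by one
    whose boundary terms are merely bounded. *)
Lemma step_fourier_decay (p : R) (eps : int -> R) (m : nat) (S : R -> R) (s t : R) :
  0 < p -> (forall k, `|eps k| <= 1) -> Ck m.+1 S ->
  (forall q, (q <= m.+1)%N -> L1 (derive1n q S)) ->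
  (forall q k, (q < m)%N -> eps k * derive1n q S (p * (k + 1)%:~R) =
     eps (k + 1) * derive1n q S (p * (k + 1)%:~R)) ->
  `|s| ^+ m.+1 * `|\int[mu]_w (step p eps w * (S w * cos (s * w + t)))| <=
  \int[mu]_w (2 / p * `|derive1n m S w| + 3 * `|derive1n m.+1 S w|).
Proof.
move=> p0 eps1 CS Si jump.
have H j : (j <= m)%N -> exists t',
    s ^+ j * \int[mu]_w (step p eps w * (S w * cos (s * w + t))) =
    \int[mu]_w (step p eps w * (derive1n j S w * cos (s * w + t'))).
  elim: j => [_|j IH jm]; first by exists t; rewrite expr0 mul1r.
  have [t' Ht'] := IH (ltnW jm); exists (t' + pi / 2).
  rewrite exprS -mulrA Ht' (step_parts p0 eps1 s t' (Ck_is_derive CS (ltnW jm))).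
  - rewrite -mulN1r -RintegralZl//.
      by apply: eq_Rintegral => w _; rewrite addrA cosDpihalf; ring.
    apply: (L1_step p0 eps1).
    under [X in EFin \o X]eq_fun do rewrite mulrC.
    apply: (@L1M_bounded _ _ _ 1) => //.
    + by apply: continuous_measurable_fun; exact: continuous_sin_affine.
    + by move=> w; exact: sin_max.
    + by apply: Si; exact: leqW.
  - by apply: (Ck_continuous CS); exact: leqW.
  - by apply: Si; rewrite leqW// ltnW.
  - by apply: Si; exact: leqW.
  - by move=> k; exact: jump.
have [t' Ht'] := H m (leqnn m).
rewrite exprS -mulrA -normrX -normrM Ht' -normrM.
apply: step_last_bound; [exact: p0|exact: eps1|..].
- exact: (Ck_is_derive CS (ltnSn m)).
- exact: (Ck_continuous CS (leqnn _)).
- by apply: Si; exact: leqnSn.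
- exact: Si.
Qed.

End decay.

(** * Vanishing derivatives *)
Section flatness.
Context {R : realType}.
Local Notation mu := (@lebesgue_measure R).

Lemma is_derive_pow (a c x : R) (j : nat) :
  is_derive x 1 (fun y : R => c / j.+1`!%:R * (y - a) ^+ j.+1) (c / j`!%:R * (x - a) ^+ j).
Proof.
have -> : (fun y : R => c / j.+1`!%:R * (y - a) ^+ j.+1) =
    (c / j.+1`!%:R) \*: ((id : R -> R) - cst a) ^+ j.+1.
  by apply/funext => y; rewrite /GRing.scale/= fctE.
apply: is_derive_eq; rewrite /GRing.scale/= subr0 mulr1 factS natrM.
have f0 : j`!%:R != 0 :> R by rewrite pnatr_eq0 -lt0n fact_gt0.
have j0 : j.+1%:R != 0 :> R by rewrite pnatr_eq0.
rewrite !fctE/= -mulr_natl.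
by move: (j.+1%:R) j0 (j`!%:R) f0 => u u0 v v0; field; rewrite u0 v0.
Qed.

(** The sequence g is a chain of successive antiderivatives vanishing at a, so
    a lower bound c on the first becomes, by repeated integration, the lower
    bound c (x - a)^j / j!. *)
Lemma iterated_integral_lower (g : nat -> R -> R) (q : nat) (a c eta : R) :
  (forall j, (j < q)%N -> forall x : R, is_derive x 1 (g j.+1) (g j x)) ->
  (forall j, (j < q)%N -> g j.+1 a = 0) ->
  (forall x, a <= x <= a + eta -> c <= g 0%N x) ->
  forall j, (j <= q)%N -> forall x, a <= x <= a + eta -> c / j`!%:R * (x - a) ^+ j <= g j x.
Proof.
move=> dg ga g0; elim=> [_ x xa|j IH jq x /andP[ax xa]].
  by rewrite fact0 divr1 expr0 mulr1 g0.
pose d y := g j.+1 y - c / j.+1`!%:R * (y - a) ^+ j.+1.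
have dd (y : R) : is_derive y 1 d (g j y - c / j`!%:R * (y - a) ^+ j).
  have -> : d = g j.+1 - (fun y : R => c / j.+1`!%:R * (y - a) ^+ j.+1) by [].
  by have := dg j jq y; have := is_derive_pow a c y j => ? ?; apply: is_deriveB.
have cd : {within `[a, x], continuous d}.
  by apply: continuous_subspaceT; exact: (is_derive_continuous dd).
have [xi] := MVT_segment ax (fun y _ => dd y) cd.
rewrite in_itv/= => /andP[axi xix].
have -> : d a = 0 by rewrite /d ga// subrr expr0n mulr0 subr0.
rewrite -subr_ge0 -[X in 0 <= X]/(d x) subr0 => ->; apply: mulr_ge0; last by rewrite subr_ge0.
by rewrite subr_ge0 IH// ?(ltnW jq)// axi (le_trans xix).
Qed.

(** Let q < m be the least order whose derivative v at a is nonzero. Near a the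
    derivative of order q stays beyond v / 2, so by [iterated_integral_lower]
    |f x| is at least a multiple of (x - a)^q on the right of a, which
    contradicts the bound by (x - a)^m. *)
Lemma flat_derivatives (n m : nat) (f : R -> R) (a K delta : R) : 0 < delta ->
  Ck n f -> (m <= n)%N ->
  (forall x, `|x - a| < delta -> `|f x| <= K * `|x - a| ^+ m) ->
  forall q, (q < m)%N -> derive1n q f a = 0.
Proof.
move=> delta0 Cf mn fK.
elim/ltn_ind => q IH qm; apply/eqP/negP => /negP v0.
set v := derive1n q f a in v0.
have cfq : continuous (derive1n q f) by apply: (Ck_continuous Cf); rewrite (leq_trans (ltnW qm)).
(* multiplying by the sign of v makes the derivative of order q positive *)
pose s := Num.sg v.
have sv : s * v = `|v| by rewrite -normrEsg.
have s1 : `|s| = 1 by rewrite normr_sg v0.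
have c0 : 0 < `|v| / 2 by rewrite divr_gt0 ?normr_gt0.
have : \forall x \near a, `|v - derive1n q f x| < `|v| / 2.
  by move/cvgrPdist_lt : (cfq a); apply.
move=> [e1 /= e10 he1].
pose g j x := s * derive1n (q - j) f x.
pose eta := Num.min (e1 / 2) (delta / 2).
have eta0 : 0 < eta by rewrite lt_min !divr_gt0.
have lower := @iterated_integral_lower g q a (`|v| / 2) eta.
have {lower} lower x : a <= x <= a + eta -> `|v| / 2 / q`!%:R * (x - a) ^+ q <= s * f x.
  move=> xa; have -> : s * f x = g q x by rewrite /g subnn.
  apply: lower (leqnn q) _ xa.
  - move=> j jq y; rewrite /g.
    have -> : (fun x => s * derive1n (q - j.+1) f x) = s \*: derive1n (q - j.+1) f by [].
    have qj : (q - j)%N = (q - j.+1).+1 by rewrite subnSK.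
    rewrite qj; have dq := @Ck_is_derive R n (q - j.+1) f Cf _ y.
    have /dq : (q - j.+1 < n)%N.
      by rewrite (leq_trans _ mn)// (leq_ltn_trans _ qm)// leq_subr.
    by move=> ?; apply: is_derive_eq.
  - by move=> j jq; rewrite /g IH ?mulr0 ?ltn_subrL ?(leq_ltn_trans _ qm) ?leq_subr//= (leq_trans _ jq).
  - move=> y /andP[ay ya]; rewrite /g subn0.
    have : `|v - derive1n q f y| < `|v| / 2.
      apply: he1 => /=; rewrite distrC ger0_norm ?subr_ge0//.
      rewrite ltrBlDl (le_lt_trans ya)// ltrD2l.
      by rewrite gt_min ltr_pdivrMr// ltr_pMr// ltr1n.
    have -> : s * derive1n q f y = `|v| - s * (v - derive1n q f y) by rewrite -sv; ring.
    have : s * (v - derive1n q f y) <= `|v - derive1n q f y|.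
      by rewrite (le_trans (ler_norm _))// normrM s1 mul1r.
    lra.
pose c := `|v| / 2 / q`!%:R.
have cp : 0 < c by rewrite divr_gt0// ltr0n fact_gt0.
(* at distance y the bounds c y^q <= |K| y^m <= |K| y^q y become incompatible *)
pose y := Num.min (Num.min eta 1) (c / (2 * (`|K| + 1))).
have K1 : 0 < 2 * (`|K| + 1) by rewrite mulr_gt0// ltr_wpDl.
have y0 : 0 < y by rewrite lt_min divr_gt0// andbT lt_min eta0 ltr01.
have yeta : y <= eta by rewrite ge_min; apply/orP; left; rewrite ge_min lexx.
have y1 : y <= 1 by rewrite ge_min; apply/orP; left; rewrite ge_min lexx orbT.
have yc : y <= c / (2 * (`|K| + 1)) by rewrite ge_min lexx orbT.
have := lower (a + y); rewrite lerDl (ltW y0) lerD2l yeta => /(_ isT).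
rewrite addrAC subrr add0r -/c => h1.
have h2 : s * f (a + y) <= `|K| * y ^+ m.
  rewrite (le_trans (ler_norm _))// normrM s1 mul1r.
  have yd : y < delta.
    rewrite (le_lt_trans yeta)// gt_min; apply/orP; right.
    by rewrite ltr_pdivrMr// ltr_pMr// ltr1n.
  have := fK (a + y); rewrite addrAC subrr add0r (gtr0_norm y0) => /(_ yd) /le_trans; apply.
  by rewrite ler_wpM2r ?ler_norm// exprn_ge0// ltW.
have h3 : y ^+ m <= y ^+ q * y.
  by rewrite -exprSr ler_wiXn2l ?(ltW y0).
have h4 : c * y ^+ q <= `|K| * (y ^+ q * y).
  by rewrite (le_trans h1)// (le_trans h2)// ler_wpM2l.
have yq0 : 0 < y ^+ q by rewrite exprn_gt0.
have : c <= `|K| * y by rewrite -(ler_pM2r yq0) (le_trans h4)// le_eqVlt; apply/orP; left; apply/eqP; ring.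
have : `|K| * y <= `|K| * (c / (2 * (`|K| + 1))) by rewrite ler_wpM2l.
have -> : `|K| * (c / (2 * (`|K| + 1))) = c * (`|K| / (2 * (`|K| + 1))) by ring.
have : `|K| / (2 * (`|K| + 1)) <= 1 / 2.
  rewrite ler_pdivrMr//; have := normr_ge0 K; lra.
nra.
Qed.

(** A strict inequality in the wrong direction would hold on a ball, which is
    not negligible. *)
Lemma ae_le_continuous (F G : R -> R) (delta : R) : continuous F -> continuous G ->
  {ae mu, forall x, `|x| < delta -> F x <= G x} -> forall x, `|x| < delta -> F x <= G x.
Proof.
move=> cF cG [N [mN N0 hN]] x xd; rewrite leNgt; apply/negP => GF.
have : \forall y \near x, `|y| < delta /\ 0 < F y - G y.
  have cFG : {for x, continuous (fun y => F y - G y)} by apply: cvgB; [exact: cF|exact: cG].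
  near=> y; split; near: y.
    have := @norm_continuous _ _ x; move/cvgr_lt; exact.
  by move/cvgr_gt : cFG; apply; rewrite subr_gt0.
move=> [r /= r0 hr].
have bN : ball x r `<=` N.
  move=> y /hr [yd FG]; apply: hN => /(_ yd); apply/negP.
  by rewrite -ltNge -subr_gt0.
have : (mu (ball x r) <= mu N)%E by apply: le_measure; rewrite ?inE//; exact: measurable_ball.
rewrite N0 lebesgue_measure_ball ?(ltW r0)// lee_fin; apply/negP; rewrite -ltNge.
by rewrite pmulrn_lgt0.
Unshelve. all: by end_near. Qed.

End flatness.

(** * Flatness of the scaling function at multiples of 2 pi *)
Section filterbank.
Context {R : realType}.
Local Notation mu := (@lebesgue_measure R).

Lemma mulcJ_normc (z : R[i]) : z * z^*%C = (ComplexField.Normc.normc z ^+ 2)%:C.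
Proof.
by rewrite normc_sqr; case: z => a b; apply/eqP; rewrite eq_complex/=; apply/andP; split;
  apply/eqP; ring.
Qed.

Lemma sqmod_ge0 (F : R -> R[i]) w : 0 <= sqmod F w.
Proof. exact: sqr_ge0. Qed.

Lemma ae_implies (P Q : R -> Prop) : {ae mu, forall x, P x} -> (forall x, P x -> Q x) ->
  {ae mu, forall x, Q x}.
Proof.
move=> [N [mN N0 PN]] PQ; exists N; split => // x nQ.
by apply: PN => Px; apply: nQ; exact: PQ.
Qed.

Lemma ae_implies2 (P Q S : R -> Prop) : {ae mu, forall x, P x} -> {ae mu, forall x, Q x} ->
  (forall x, P x -> Q x -> S x) -> {ae mu, forall x, S x}.
Proof.
move=> aeP aeQ PQ; move: aeP aeQ.
by apply: (@filterS2 _ _ (ae_filter_ringOfSetsType _)) => x; exact: PQ.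
Qed.

(** Up to the factor M, the adjoint of U is a right inverse, hence also a left
    inverse. *)
Lemma unitary_column_norm (M : nat) (U : 'M[R[i]]_M) (p : 'I_M) : (0 < M)%N ->
  (forall m m', \sum_q U m q * (U m' q)^*%C = (M * (m == m'))%:R) ->
  \sum_m ComplexField.Normc.normc (U m p) ^+ 2 = M%:R.
Proof.
move=> M0 UU.
have Mn0 : M%:R != 0 :> R[i] by rewrite pnatr_eq0 -lt0n.
pose V : 'M[R[i]]_M := \matrix_(q, m) (M%:R^-1 * (U m q)^*%C).
have UV : U *m V = 1%:M.
  apply/matrixP => m m'; rewrite !mxE.
  under eq_bigr do rewrite mxE mulrCA.
  rewrite -mulr_sumr UU natrM mulrA mulVf// mul1r.
  by case: eqP.
have /matrixP/(_ p p) := mulmx1C UV; rewrite !mxE eqxx/= => h.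
apply: (@complexI R); rewrite rmorph_sum/= rmorph_nat.
have := congr1 ( *%R M%:R) h; rewrite mulr1 mulr_sumr => <-.
by apply: eq_bigr => m _; rewrite mxE -mulcJ_normc mulrA mulrA divff// mul1r mulrC.
Qed.

Lemma continuous_norm_pow (K : R) (n : nat) : continuous (fun x : R => K * `|x| ^+ n).
Proof.
have c1 : continuous (fun x : R => `|x|) by move=> x; exact: norm_continuous.
have c2 : continuous (fun x : R => K * x ^+ n).
  by move=> x; apply: cvgM; [exact: cvg_cst|exact: exprn_continuous].
by move=> x; exact: (continuous_comp (c1 x) (c2 _)).
Qed.

Lemma uniform_flat_bound (M : nat) (F : nat -> R -> R) (n : nat) :
  (forall m, (m < M)%N -> exists K delta : R, 0 < delta /\
     forall w : R, `|w| < delta -> F m w <= K * `|w| ^+ n) ->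
  exists K delta : R, [/\ 0 <= K, 0 < delta &
    forall m, (m < M)%N -> forall w : R, `|w| < delta -> F m w <= K * `|w| ^+ n].
Proof.
elim: M => [_|M IH HF]; first by exists 0, 1.
have [m mM|K1 [d1 [K10 d10 H1]]] := IH; first by apply: HF; exact: ltnW.
have [K2 [d2 [d20 H2]]] := HF M (ltnSn M).
exists (K1 + `|K2|), (Num.min d1 d2); split; rewrite ?addr_ge0 ?lt_min ?d10//.
move=> m; rewrite ltnS leq_eqVlt => /predU1P[->|mM] w; rewrite lt_min => /andP[w1 w2].
  by rewrite (le_trans (H2 w w2))// ler_wpM2r ?exprn_ge0// (le_trans (ler_norm _))// lerDr.
by rewrite (le_trans (H1 m mM w w1))// ler_wpM2r ?exprn_ge0// lerDl.
Qed.

Variables (M : nat) (hatpsi H : nat -> R -> R[i]) (n : nat).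
Hypothesis M1 : (1 < M)%N.
Hypothesis periodic : forall m, (m < M)%N -> forall w, H m (w + 2 * pi) = H m w.
Hypothesis two_scale : forall m, (m < M)%N -> {ae mu, forall w : R,
    (Num.sqrt M%:R)%:C * hatpsi m (M%:R * w) = H m w * hatpsi 0%N w}.
Hypothesis paraunitary : forall m m', (m < M)%N -> (m' < M)%N ->
    {ae mu, forall w : R,
      \sum_(p < M) H m (w + 2 * pi * p%:R / M%:R)
                   * (H m' (w + 2 * pi * p%:R / M%:R))^*%C
      = (M * (m == m'))%:R}.
Hypothesis lowpass : hatpsi 0%N 0 = 1.
Hypothesis cont0 : continuous (sqmod (hatpsi 0%N)).
Hypothesis vanish : forall m, (1 <= m < M)%N -> exists K delta : R, 0 < delta /\
  forall w : R, `|w| < delta -> sqmod (hatpsi m) w <= K * `|w| ^+ n.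

Let S0 := sqmod (hatpsi 0%N).
Let h m := sqmod (H m).
Let MR : 0 < M%:R :> R. Proof. by rewrite ltr0n ltnW. Qed.

Lemma two_scale_sqmod m : (m < M)%N ->
  {ae mu, forall w : R, M%:R * sqmod (hatpsi m) (M%:R * w) = h m w * S0 w}.
Proof.
move=> mM; apply: (ae_implies (two_scale mM)) => w /(congr1 (@ComplexField.Normc.normc R)).
rewrite !ComplexField.Normc.normcM => /(congr1 (fun x => x ^+ 2)).
rewrite !exprMn normc_sqr/= expr0n/= addr0 sqr_sqrtr ?(ltW MR)//.
Qed.

(** The squared norms of the first column and of the first row of the
    matrix (H_m(w + 2 pi p / M))_{m,p}. *)
Lemma filter_norms : {ae mu, forall w : R,
  \sum_(m < M) h m w = M%:R /\ \sum_(p < M) h 0%N (w + 2 * pi * p%:R / M%:R) = M%:R}.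
Proof.
have : {ae mu, forall w : R, forall m m' : nat, (m < M)%N -> (m' < M)%N ->
      \sum_(p < M) H m (w + 2 * pi * p%:R / M%:R)
                   * (H m' (w + 2 * pi * p%:R / M%:R))^*%C
      = (M * (m == m'))%:R}.
  apply: ae_foralln => m; apply: ae_foralln => m'.
  have [mM|mM] := ltnP m M; last by apply: aeW.
  have [m'M|m'M] := ltnP m' M; last by apply: aeW.
  by apply: (ae_implies (paraunitary mM m'M)).
move=> aeH; apply: (ae_implies aeH) => w Hw; have M0 := ltnW M1; split; last first.
  have := Hw 0%N 0%N M0 M0; rewrite eqxx muln1.
  under eq_bigr do rewrite mulcJ_normc.
  by rewrite -rmorph_sum/= -[RHS](rmorph_nat (@real_complex R)) => /complexI.
pose U : 'M[R[i]]_M := \matrix_(m, p) H m (w + 2 * pi * p%:R / M%:R).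
have := @unitary_column_norm M U (Ordinal M0) M0.
move=> <-; last first.
  move=> m m'; under eq_bigr do rewrite !mxE.
  by rewrite Hw//.
by apply: eq_bigr => m _; rewrite mxE/= mulr0 mul0r addr0.
Qed.

Lemma lowpass_le : {ae mu, forall w : R, h 0%N w <= M%:R}.
Proof.
apply: (ae_implies filter_norms) => w [<- _].
rewrite (bigD1 (Ordinal (ltnW M1)))//= lerDl sumr_ge0// => m _; exact: sqmod_ge0.
Qed.

(** The constant 1/2 is any number below the value 1 at the origin. *)
Lemma scaling_near0 : exists2 delta : R, 0 < delta & forall w, `|w| < delta -> 1 / 2 <= S0 w.
Proof.
have S00 : S0 0 = 1 by rewrite /S0 /sqmod lowpass normc_sqr/= expr0n/= expr1n addr0.
have : \forall w \near 0, 1 / 2 < S0 w.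
  have c0 : {for (0 : R), continuous S0} by exact: cont0.
  by move/cvgr_gt : c0; apply; rewrite S00; lra.
move=> [d /= d0 hd]; exists d => // w wd.
by apply: ltW; apply: hd; rewrite /= sub0r normrN.
Qed.

(** Divide the two-scale relation M |hatpsi_m(M w)|^2 = |H_m(w)|^2 |hatpsi_0(w)|^2
    by |hatpsi_0(w)|^2 >= 1/2. *)
Lemma highpass_flat : exists K delta : R, [/\ 0 <= K, 0 < delta &
  {ae mu, forall w : R, `|w| < delta -> forall m, (1 <= m < M)%N -> h m w <= K * `|w| ^+ n}].
Proof.
have [d1 d10 hd1] := scaling_near0.
pose F m w := if m == 0%N then 0 else sqmod (hatpsi m) w.
have [m mM|K [d2 [K0 d20 hd2]]] := @uniform_flat_bound M F n.
  rewrite /F; case: eqP => [_|/eqP m0]; first by exists 0, 1; split => // w _; rewrite mul0r.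
  by apply: vanish; rewrite lt0n m0.
exists (2 * (M%:R * (K * M%:R ^+ n))), (Num.min d1 (d2 / M%:R)); split.
- by rewrite !mulr_ge0 ?exprn_ge0 ?(ltW MR).
- by rewrite lt_min d10 divr_gt0.
have : {ae mu, forall w : R, forall m, (m < M)%N ->
    M%:R * sqmod (hatpsi m) (M%:R * w) = h m w * S0 w}.
  apply: ae_foralln => m; have [mM|mM] := ltnP m M; last by apply: aeW.
  by apply: (ae_implies (two_scale_sqmod mM)).
move=> aeH; apply: (ae_implies aeH) => w Hw; rewrite lt_min => /andP[w1 w2] m /andP[m1 mM].
have S0w := hd1 w w1.
have Mw : `|M%:R * w| < d2 by rewrite normrM gtr0_norm// mulrC -ltr_pdivlMr.
have := hd2 m mM _ Mw; rewrite /F gtn_eqF// normrM (gtr0_norm MR) exprMn => Sm.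
have E := Hw m mM.
have h0 : 0 <= h m w by exact: sqmod_ge0.
have : h m w <= 2 * (h m w * S0 w) by nra.
move=> /le_trans; apply; rewrite -E -!mulrA ler_wpM2l// ler_wpM2l ?(ltW MR)//.
Qed.

(** The row and the column of [filter_norms] share the entry |H_0(w)|^2, so the
    sum of |H_0(w + 2 pi p / M)|^2 over p > 0 equals that of the high-pass terms
    |H_m(w)|^2 over m > 0, which are flat. *)
Lemma alias_flat : exists K delta : R, [/\ 0 <= K, 0 < delta &
  {ae mu, forall w : R, `|w| < delta -> forall p, (1 <= p < M)%N ->
     h 0%N (w + 2 * pi * p%:R / M%:R) <= K * `|w| ^+ n}].
Proof.
have [K [d [K0 d0 hp]]] := highpass_flat.
exists (M%:R * K), d; split => //; first by rewrite mulr_ge0 ?(ltW MR).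
apply: (ae_implies2 hp filter_norms) => w hw [s1 s2] wd p /andP[p1 pM].
have M0 := ltnW M1.
have e1 : h 0%N w + \sum_(m < M | m != Ordinal M0) h m w = M%:R.
  by rewrite -[RHS]s1 [RHS](bigD1 (Ordinal M0)).
have e2 : h 0%N w + \sum_(q < M | q != Ordinal M0) h 0%N (w + 2 * pi * q%:R / M%:R) = M%:R.
  by rewrite -[RHS]s2 [RHS](bigD1 (Ordinal M0))//= mulr0 mul0r addr0.
have /addrI e3 := etrans e1 (esym e2).
have : h 0%N (w + 2 * pi * p%:R / M%:R) <=
    \sum_(q < M | q != Ordinal M0) h 0%N (w + 2 * pi * q%:R / M%:R).
  rewrite (bigD1 (Ordinal pM))/=; last by rewrite -val_eqE/= -lt0n.
  by rewrite lerDl sumr_ge0// => q _; exact: sqmod_ge0.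
move=> /le_trans; apply; rewrite -e3.
apply: (@le_trans _ _ (\sum_(m < M) K * `|w| ^+ n)); last first.
  by rewrite sumr_const card_ord -[leLHS]mulr_natl mulrA.
rewrite [leRHS](bigID (fun m : 'I_M => m != Ordinal M0))/=.
rewrite -[leLHS]addr0 lerD//; last by rewrite sumr_ge0// => m _; rewrite mulr_ge0 ?exprn_ge0.
apply: ler_sum => m; rewrite -val_eqE/= -lt0n => m0; apply: hw => //.
by rewrite m0 /=.
Qed.

Lemma periodic_int (m : nat) (q : int) (w : R) : (m < M)%N ->
  H m (w + 2 * pi * q%:~R) = H m w.
Proof.
move=> mM.
have Hn (k : nat) w' : H m (w' + 2 * pi * k%:R) = H m w'.
  elim: k => [|k IH]; first by rewrite mulr0 addr0.
  by rewrite -[k.+1%:R]natr1 mulrDr mulr1 addrA periodic.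
case: q => k; first exact: Hn.
by rewrite NegzE mulrNz mulrN -(Hn k.+1 (w - _)) subrK.
Qed.

(** Induction on |k|, through the two-scale relation at the point 2 pi k / M:
    if M divides k, that point is a smaller nonzero multiple of 2 pi and the
    low-pass filter is bounded; otherwise the filter itself is flat there, by
    periodicity and [alias_flat], and hatpsi_0 is bounded. *)
Lemma scaling_flat (k : int) : k != 0 -> exists K delta : R, 0 < delta /\
  forall x : R, `|x| < delta -> S0 (2 * pi * k%:~R + x) <= K * `|x| ^+ n.
Proof.
have [N] := ubnP `|k|%N; elim: N k => // N IH k kN k0.
have Mi0 : 0 < M%:R^-1 :> R by rewrite invr_gt0.
have Mn0 : M%:R != 0 :> R by rewrite gt_eqF.
set c : R := 2 * pi * k%:~R / M%:R.
pose y (x : R) := M%:R^-1 * x + c.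
have yE x : M%:R * y x = 2 * pi * k%:~R + x.
  by rewrite /y /c; field.
have ts := ae_affine c Mi0 (two_scale_sqmod (ltnW M1)).
(* y x is the point whose dilation by M is 2 pi k + x *)
suff [K [d [d0 Hd]]] : exists K delta : R, 0 < delta /\
   {ae mu, forall x : R, `|x| < delta -> h 0%N (y x) * S0 (y x) <= K * `|x| ^+ n}.
  exists (K / M%:R), d; split => //.
  apply: (@ae_le_continuous R (fun x => S0 (2 * pi * k%:~R + x)) (fun x => K / M%:R * `|x| ^+ n)).
  - move=> x; apply: (@continuous_cvg _ _ _ _ _ _ S0); first exact: cont0.
    by apply: cvgD; [exact: cvg_cst|exact: cvg_id].
  - exact: continuous_norm_pow.
  - apply: (ae_implies2 Hd ts) => x Hx tsx xd; move: (Hx xd); rewrite -tsx -/(y x) yE.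
    by rewrite -ler_pdivlMl// mulrA [_^-1 * K]mulrC.
have [Mk|Mk] := boolP (M%:Z %| k)%Z.
  have [q kq] := dvdzP Mk.
  have q0 : q != 0 by apply: contraNneq k0 => q0; rewrite kq q0 mul0r.
  have qk : (`|q| < `|k|)%N by rewrite kq abszM ltn_Pmulr// absz_gt0.
  have [K [d [d0 Hd]]] := IH q (leq_trans qk kN) q0.
  exists (M%:R * `|K|), d; split => //.
  have lp := ae_affine c Mi0 lowpass_le.
  apply: (ae_implies lp) => x; rewrite -/(y x) => hy xd.
  have yq : y x = 2 * pi * q%:~R + M%:R^-1 * x.
    by rewrite /y /c kq intrM -mulrA mulfK ?gt_eqF// addrC.
  have xM : `|M%:R^-1 * x| <= `|x|.
    by rewrite normrM ler_piMl// gtr0_norm// invf_le1// ler1n ltnW.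
  have Sy : S0 (y x) <= `|K| * `|x| ^+ n.
    rewrite yq (le_trans (Hd _ (le_lt_trans xM xd)))//.
    rewrite (@le_trans _ _ (`|K| * `|M%:R^-1 * x| ^+ n))//.
      by rewrite ler_wpM2r ?exprn_ge0// ler_norm.
    by rewrite ler_wpM2l// lerXn2r ?nnegrE.
  by rewrite -[leRHS]mulrA; exact: (ler_pM (sqmod_ge0 _ _) (sqmod_ge0 _ _) hy Sy).
pose q := (k %/ M%:Z)%Z; pose r := `|(k %% M%:Z)%Z|%N.
have MZ : M%:Z != 0 by rewrite -lt0n ltnW.
have rE : (k %% M%:Z)%Z = r%:Z by rewrite /r gez0_abs// modz_ge0.
have kE : k = q * M%:Z + r%:Z by rewrite -rE; exact: divz_eq.
have r1 : (1 <= r < M)%N.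
  apply/andP; split.
    by rewrite lt0n; apply: contra Mk => /eqP r0; rewrite kE r0 addr0 dvdz_mull.
  by rewrite -ltz_nat -rE ltz_mod.
have [K [d [K0 d0 al]]] := alias_flat.
have [d2 d20 hd2] : exists2 d2 : R, 0 < d2 & forall u, `|u| < d2 -> S0 (c + u) <= S0 c + 1.
  have cc : {for c, continuous S0} by exact: cont0.
  have : \forall u \near c, S0 u < S0 c + 1.
    by move/cvgr_lt : cc; apply; rewrite ltrDl.
  move=> [e /= e0 he]; exists e => // u ue; apply: ltW; apply: he => /=.
  by rewrite opprD addNKr normrN.
exists (K * (S0 c + 1)), (Num.min d d2); split; first by rewrite lt_min d0.
apply: (ae_implies (ae_affine 0 Mi0 al)) => x; rewrite addr0 => hx.
rewrite lt_min => /andP[xd xd2].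
have xM : `|M%:R^-1 * x| <= `|x|.
  by rewrite normrM ler_piMl// gtr0_norm// invf_le1// ler1n ltnW.
have hy : h 0%N (y x) = h 0%N (M%:R^-1 * x + 2 * pi * r%:R / M%:R).
  rewrite /h /sqmod -(periodic_int q (M%:R^-1 * x + 2 * pi * r%:R / M%:R) (ltnW M1)).
  congr (ComplexField.Normc.normc (H 0%N _) ^+ 2).
  rewrite /y /c {1}kE intrD intrM -!pmulrn; field.
  done.
have hK : h 0%N (y x) <= K * `|x| ^+ n.
  rewrite hy (le_trans (hx (le_lt_trans xM xd) r r1))// ler_wpM2l// lerXn2r ?nnegrE//.
have SK : S0 (y x) <= S0 c + 1.
  by rewrite /y addrC; apply: hd2; exact: le_lt_trans xd2.
by rewrite [leRHS]mulrAC; exact: (ler_pM (sqmod_ge0 _ _) (sqmod_ge0 _ _) hK SK).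
Qed.

End filterbank.

(** * Decay of the correlations *)
Section assembly.
Context {R : realType}.
Local Notation mu := (@lebesgue_measure R).
Local Notation L1 f := (mu.-integrable setT (EFin \o f)).

Lemma twopi_gt0 : 0 < 2 * pi :> R. Proof. by rewrite mulr_gt0// pi_gt0. Qed.

Lemma cross_spectrum_self (F : R -> R[i]) (tau w : R) :
  cross_spectrum F F tau w = sqmod F w * cos (tau * w).
Proof. by rewrite /cross_spectrum /sqmod normc_sqr; ring. Qed.

Definition sign_cell (k : int) : R := if 0 <= k then 1 else -1.

Lemma sign_cell_le1 k : `|sign_cell k| <= 1.
Proof. by rewrite /sign_cell; case: ifP => _; rewrite ?normrN normr1. Qed.

Lemma sign_cell_succ k : k + 1 != 0 -> sign_cell (k + 1) = sign_cell k.
Proof.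
rewrite /sign_cell => k1; congr (if _ then _ else _).
by rewrite le_eqVlt eq_sym (negbTE k1) ltzD1.
Qed.

Lemma sg_step (w : R) : w != 0 -> Num.sg w = step (2 * pi) sign_cell w.
Proof.
move=> w0; rewrite /step /sign_cell floor_ge0 pmulr_lge0 ?invr_gt0 ?twopi_gt0//.
case: ltgtP w0 => // w0 _; [exact: gtr0_sg|exact: ltr0_sg].
Qed.

Lemma cross_spectrum_sg (F : R -> R[i]) (tau w : R) :
  cross_spectrum F (fun w => (0 -i* Num.sg w) * F w) tau w =
  step (2 * pi) sign_cell w * (sqmod F w * cos (tau * w + pi / 2)).
Proof.
rewrite /cross_spectrum /sqmod normc_sqr cosDpihalf.
have [->|w0] := eqVneq w 0; first by rewrite mulr0 sgr0 sin0; case: (F 0) => a b /=; ring.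
by rewrite -sg_step//; case: (F w) => a b /=; ring.
Qed.

Definition phase_cell (k : int) : R := if 0 <= k then (-1) ^ k else (-1) ^ (k + 1).

Lemma phase_cell_le1 k : `|phase_cell k| <= 1.
Proof.
have norm1 (z : int) : `|(-1 : R) ^ z| = 1.
  by case: z => n; rewrite ?NegzE -?exprnN -?exprnP ?normfV normrX normrN1 expr1n ?invr1.
by rewrite /phase_cell; case: ifP => _; rewrite norm1.
Qed.

(** The exponents k + 1 = 0 and k = 0 of the two branches agree: the origin, where
    hatpsi_0 is 1, is not a jump of the phase. *)
Lemma phase_cell_origin k : k + 1 = 0 -> phase_cell (k + 1) = phase_cell k.
Proof.
by move=> k1; rewrite /phase_cell -[0 <= k]ltzD1 k1 ltxx lexx.
Qed.

Lemma dual_phaseE (d : int) (w : R) : dual_phase d w =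
  (step (2 * pi) phase_cell w)%:C * expi (- ((d%:~R + 1 / 2) * w)).
Proof.
rewrite /dual_phase /step /phase_cell; congr (_ * _).
by case: ifP => _; rewrite fmorphXz/= rmorphN1.
Qed.

(** The factor exp(- i (d + 1/2) w) of the dual only translates tau; its signs
    form a step function on the cells of length 2 pi. *)
Lemma cross_spectrum_phase (F : R -> R[i]) (d : int) (tau w : R) :
  cross_spectrum F (fun w => dual_phase d w * F w) tau w =
  step (2 * pi) phase_cell w * (sqmod F w * cos ((tau + (d%:~R + 1 / 2)) * w + 0)).
Proof.
rewrite /cross_spectrum /sqmod normc_sqr dual_phaseE addr0.
rewrite [(tau + _) * w]mulrDl cosD /expi cosN sinN.
by case: (F w) => a b /=; ring.
Qed.

Lemma exprD_le (a b : R) n : 0 <= a -> 0 <= b ->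
  (a + b) ^+ n <= 2 ^+ n * (a ^+ n + b ^+ n).
Proof.
move=> a0 b0; have [ab|/ltW ba] := leP a b.
  rewrite (@le_trans _ _ ((2 * b) ^+ n))//; last by rewrite exprMn ler_pM2l ?exprn_gt0// lerDr exprn_ge0.
  by rewrite lerXn2r ?nnegrE ?addr_ge0 ?mulr_ge0//; lra.
rewrite (@le_trans _ _ ((2 * a) ^+ n))//; last by rewrite exprMn ler_pM2l ?exprn_gt0// lerDl exprn_ge0.
by rewrite lerXn2r ?nnegrE ?addr_ge0 ?mulr_ge0//; lra.
Qed.

(** The decay is in |tau + c|; it passes to |tau| because the correlation is
    bounded and |tau|^(n + 1) is at most 2^(n + 1) (|tau + c|^(n + 1) + |c|^(n + 1)). *)
Lemma crosscorr_decay (f g : R -> R) (F G : R -> R[i]) (n : nat) (S : R -> R)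
    (eps : int -> R) (c t : R) :
  is_fourier f F -> is_fourier g G ->
  Ck n.+1 S -> (forall q, (q <= n.+1)%N -> L1 (derive1n q S)) ->
  (forall k, `|eps k| <= 1) ->
  (forall (q : nat) (k : int), (q < n)%N ->
    eps k * derive1n q S (2 * pi * (k + 1)%:~R) =
    eps (k + 1) * derive1n q S (2 * pi * (k + 1)%:~R)) ->
  (forall tau w : R, cross_spectrum F G tau w =
    step (2 * pi) eps w * (S w * cos ((tau + c) * w + t))) ->
  exists C : R, forall tau : R, `|tau| ^+ n.+1 * `|crosscorr f g tau| <= C.
Proof.
move=> fF gG CkS iS eps1 jump spec.
set B := \int[mu]_w (2 / (2 * pi) * `|derive1n n S w| + 3 * `|derive1n n.+1 S w|).
set A := \int[mu]_w `|S w|.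
exists ((2 * pi)^-1 * (2 ^+ n.+1 * (B + `|c| ^+ n.+1 * A))) => tau.
have LS : L1 S := iS 0%N isT.
have cS : continuous S by exact: (Ck_continuous CkS (leq0n _)).
have p0 := twopi_gt0.
have -> : crosscorr f g tau = (2 * pi)^-1 *
    \int[mu]_w (step (2 * pi) eps w * (S w * cos ((tau + c) * w + t))).
  apply: (mulfI (lt0r_neq0 p0)); rewrite mulVKf ?lt0r_neq0// (crosscorr_parseval tau fF gG).
  by apply: eq_Rintegral => w _; exact: spec.
set I := \int[mu]_w _.
have I1 : `|tau + c| ^+ n.+1 * `|I| <= B by exact: step_fourier_decay.
have I2 : `|I| <= A.
  have Lc : L1 (fun w => S w * cos ((tau + c) * w + t)).
    apply: (L1_le _ (L1_norm LS)) => [|w].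
      by apply: continuous_measurable_fun; exact: continuous_cos_affineM.
    by rewrite normrM ler_piMr// ler_norml cos_geN1 cos_le1.
  have Li : L1 (fun w => step (2 * pi) eps w * (S w * cos ((tau + c) * w + t))).
    exact: (L1_step p0 eps1 Lc).
  rewrite (le_trans (le_normr_Rintegral measurableT Li))//.
  apply: le_Rintegral => //; [exact: (L1_norm Li)|exact: (L1_norm LS)|move=> w _].
  rewrite !normrM mulrCA ler_piMr//.
  by rewrite mulr_ile1// ?step_le1// ler_norml cos_geN1 cos_le1.
rewrite normrM gtr0_norm ?invr_gt0// mulrCA ler_pM2l ?invr_gt0//.
have tc : `|tau| ^+ n.+1 <= 2 ^+ n.+1 * (`|tau + c| ^+ n.+1 + `|c| ^+ n.+1).
  apply: le_trans (exprD_le _ (normr_ge0 _) (normr_ge0 _)).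
  rewrite lerXn2r ?nnegrE ?addr_ge0//.
  by rewrite -{1}(addrK c tau) ler_normB.
apply: (le_trans (ler_wpM2r (normr_ge0 _) tc)).
rewrite -mulrA ler_pM2l ?exprn_gt0// mulrDl lerD// ler_wpM2l// exprn_ge0//.
Qed.
(** The Landau relation says nothing at 0 itself; continuity fills that point. *)
Lemma bigO_sqmod_le (F : R -> R[i]) (n : nat) : continuous (sqmod F) ->
  (fun w : R => ComplexField.Normc.normc (F w) : R) =O_ (dnbhs (0 : R))
    (fun w : R => w ^+ n) ->
  exists K delta : R, 0 < delta /\
    forall w : R, `|w| < delta -> sqmod F w <= K * `|w| ^+ (2 * n).
Proof.
move=> cF /eqO_exP [K K0 /nbhs_ballP[d /= d0 hd]].
exists (K ^+ 2), d; split => // w wd.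
apply: (@ae_le_continuous _ _ (fun x : R => K ^+ 2 * `|x| ^+ (2 * n)) d cF) wd => //.
  exact: continuous_norm_pow.
exists [set 0]; split => //; first exact: lebesgue_measure_set1.
move=> x /= nx; apply: contra_notP nx => /eqP x0 xd.
have xb : ball 0 d x by rewrite /ball/= sub0r normrN.
have := hd x xb x0; rewrite /= normrX => h.
rewrite /sqmod mulnC exprM -exprMn lerXn2r ?nnegrE//.
- by case: (F x) => a b; exact: sqrtr_ge0.
- by rewrite mulr_ge0// ?ltW// exprn_ge0.
- by rewrite (le_trans _ h)// ler_norm.
Qed.

Lemma sqmod_exponent_le (f : R -> R) (n n' : nat) : (n' <= n)%N ->
  (exists K delta : R, 0 < delta /\ forall w : R, `|w| < delta -> f w <= K * `|w| ^+ n) ->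
  exists K delta : R, 0 < delta /\ forall w : R, `|w| < delta -> f w <= K * `|w| ^+ n'.
Proof.
move=> nn [K [d [d0 h]]]; exists `|K|, (Num.min d 1); split.
  by rewrite lt_min d0 ltr01.
move=> w; rewrite lt_min => /andP[wd w1]; apply: (le_trans (h w wd)).
rewrite (le_trans (ler_wpM2r _ (ler_norm K)))// ?exprn_ge0// ler_wpM2l//.
by rewrite ler_wiXn2l// ltW.
Qed.
End assembly.

Lemma bigmin_le (N : nat -> nat) (z : nat) (s : seq nat) (m : nat) : m \in s ->
  (\big[minn/z]_(i <- s) N i <= N m)%N.
Proof.
elim: s => // a s IH; rewrite inE big_cons geq_min => /predU1P[->|/IH ->];
  by rewrite ?leqnn ?orbT.
Qed.

Lemma common_bound (R : realType) (M : nat) (P : nat -> R -> Prop) :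
  (forall m, (m < M)%N -> exists C : R, P m C) ->
  (forall m C C', C <= C' -> P m C -> P m C') ->
  exists2 C : R, 0 <= C & forall m, (m < M)%N -> P m C.
Proof.
move=> ex mono; elim: M ex => [|M IH] ex; first by exists 0.
have [C C0 hC] := IH (fun m mM => ex m (ltnW mM)).
have [C' hC'] := ex M (ltnSn M).
exists (Num.max C C'); first by rewrite le_max C0.
move=> m; rewrite ltnS leq_eqVlt => /predU1P[->|mM].
  by apply: mono hC'; rewrite le_max lexx orbT.
by apply: mono (hC m mM); rewrite le_max lexx.
Qed.

Theorem proposition4 (R : realType) (M : nat) (hM : (2 <= M)%N)
    (psi : nat -> R -> R) (hatpsi H : nat -> R -> R[i])
    (hpsi : orthonormal_Mband M psi hatpsi H)
    (d : int) (psiH : nat -> R -> R)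
    (hdual : forall m, (m < M)%N ->
       is_fourier (psiH m) (dual_hat d hatpsi m))
    (N : nat -> nat)
    (hNpos : forall m, (1 <= m < M)%N -> (0 < N m)%N)
    (hN0 : N 0%N = \big[minn/N 1%N]_(1 <= m < M) N m)
    (hsmooth : forall m, (m < M)%N -> Ck (2 * N m + 1)%N (sqmod (hatpsi m)))
    (hint : forall m, (m < M)%N -> forall q, (q <= 2 * N m + 1)%N ->
       (@lebesgue_measure R).-integrable setT
         (EFin \o derive1n q (sqmod (hatpsi m))))
    (hvanish : forall m, (1 <= m < M)%N ->
       (fun w : R => ComplexField.Normc.normc (hatpsi m w) : R) =O_ (dnbhs (0 : R))
       (fun w : R => w ^+ N m)) :
  exists2 C : R, 0 <= C &
    forall m, (m < M)%N ->
      (forall tau : R, tau != 0 ->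
         `|crosscorr (psi m) (psi m) tau| <= C / `|tau| ^+ (2 * N m + 1)) /\
      (forall tau : R, tau != 0 ->
         `|crosscorr (psi m) (psiH m) tau| <= C / `|tau| ^+ (2 * N m + 1)).
Proof.
have bound (n : nat) (x C tau : R) : tau != 0 ->
    `|tau| ^+ n * x <= C -> x <= C / `|tau| ^+ n.
  by move=> t0 h; rewrite ler_pdivlMr ?exprn_gt0 ?normr_gt0// mulrC.
have [|m C C' CC' [h1 h2]|C C0 hC] := @common_bound R M (fun m C =>
    (forall tau : R, `|tau| ^+ (2 * N m + 1) * `|crosscorr (psi m) (psi m) tau| <= C) /\
    (forall tau : R, `|tau| ^+ (2 * N m + 1) * `|crosscorr (psi m) (psiH m) tau| <= C)).
- move=> m mM.
  have CkS := hsmooth m mM; have iS := hint m mM.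
  move: CkS iS; rewrite !addn1 => CkS iS.
  have fpsi := mb_fourier hpsi mM; have fdual := hdual m mM.
  have [C1 h1] : exists C : R, forall tau : R,
      `|tau| ^+ (2 * N m).+1 * `|crosscorr (psi m) (psi m) tau| <= C.
    apply: (@crosscorr_decay R _ _ _ _ _ _ (fun=> 1) 0 0 fpsi fpsi CkS iS) => //.
      by move=> _; rewrite normr1.
    by move=> tau w; rewrite cross_spectrum_self /step mul1r !addr0.
  have vanish m' : (1 <= m' < M)%N -> exists K delta : R, 0 < delta /\
      forall w : R, `|w| < delta -> sqmod (hatpsi m') w <= K * `|w| ^+ (2 * N m').
    move=> m'M; apply: bigO_sqmod_le (hvanish m' m'M).
    have /andP[_ m'lt] := m'M.
    exact: (Ck_continuous (hsmooth m' m'lt) (leq0n _)).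
  have [C2 h2] : exists C : R, forall tau : R,
      `|tau| ^+ (2 * N m).+1 * `|crosscorr (psi m) (psiH m) tau| <= C.
    have [m0|m0] := eqVneq m 0%N.
      have fdual0 : is_fourier (psiH m) (fun w => dual_phase d w * hatpsi m w).
        by move: fdual; rewrite m0.
      apply: (@crosscorr_decay R _ _ _ _ _ _ phase_cell (d%:~R + 1 / 2) 0 fpsi fdual0 CkS iS).
      + exact: phase_cell_le1.
      + move=> q k qN; have [k1|k1] := eqVneq (k + 1) 0.
          by rewrite phase_cell_origin.
        (* the exponent N 0 is the smallest, so it suits all the wavelets at once *)
        have vanish0 m' : (0 < m' < M)%N -> exists K delta : R, 0 < delta /\
            forall w : R, `|w| < delta -> sqmod (hatpsi m') w <= K * `|w| ^+ (2 * N 0).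
          move=> m'M; apply: sqmod_exponent_le (vanish m' m'M).
          by rewrite leq_pmul2l// hN0 bigmin_le// mem_index_iota.
        have M0 : (0 < M)%N by exact: ltnW.
        have [K [e [e0 hK]]] := scaling_flat hM (mb_periodic hpsi) (mb_two_scale hpsi)
          (mb_paraunitary hpsi) (mb_lowpass hpsi)
          (Ck_continuous (hsmooth 0%N M0) (leq0n _)) vanish0 k1.
        rewrite (flat_derivatives (K := K) e0 CkS (leqnSn _) _ qN) ?mulr0// => x xe.
        rewrite (ger0_norm (sqmod_ge0 _ _)) m0.
        by have := hK _ xe; rewrite addrC subrK.
      + move=> tau w; exact: cross_spectrum_phase.
    move: fdual; rewrite /dual_hat (negbTE m0) => fdual.
    apply: (@crosscorr_decay R _ _ _ _ _ _ sign_cell 0 (pi / 2) fpsi fdual CkS iS).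
    + exact: sign_cell_le1.
    + move=> q k qN; have [k1|k1] := eqVneq (k + 1) 0; last first.
        by rewrite sign_cell_succ.
      have [K [e [e0 hK]]] : exists K delta : R, 0 < delta /\
          forall w : R, `|w| < delta -> sqmod (hatpsi m) w <= K * `|w| ^+ (2 * N m).
        by apply: vanish; rewrite lt0n m0.
      rewrite (flat_derivatives (K := K) e0 CkS (leqnSn _) _ qN) ?mulr0// => x.
      by rewrite (ger0_norm (sqmod_ge0 _ _)) k1 mulr0 subr0; exact: hK.
    + by move=> tau w; rewrite addr0; exact: cross_spectrum_sg.
  exists (Num.max C1 C2); split => tau; rewrite le_max; apply/orP;
    [left; exact: h1|right; exact: h2].
- by split => tau; apply: le_trans CC'.
exists C => // m mM; have [h1 h2] := hC m mM.
by split=> tau t0; apply: bound.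
Qed.
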